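(* Let $k$ be an algebraically closed field of characteristic $p\geq 3$, let $m\geq1$ be an integer and fix $\infty\in\mathbb{P}^1_k$. 1. If $m+1=p$, there is no $L_{m+1,2}$. 2. If $m+1=2p$, there exists an $L_{m+1,2}$ if and only if $p=3$. 3. If $m+1=3p$, there is no $L_{m+1,2}$.
   Context: A differential form on $\mathbb{P}^1_k$ is called logarithmic if it is of the form $\frac{\mathrm{d}f}{f}$ with $f\in k(\mathbb{P}^1)^*$. For integers $m\geq1$, $n\geq 1$, an $L_{m+1,n}$ denotes an $\mathbb{F}_p$-vector space of dimension $n$ of logarithmic differential forms on $\mathbb{P}^1_k$ such that every nonzero element has exactly one zero, at the fixed point $\infty$, of order $m-1$. *)

(* Defs.v *)
From HB Require Import structures.
From mathcomp Require Import all_boot all_order all_algebra.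
From mathcomp Require Import ring zify.

Set Implicit Arguments.
Unset Strict Implicit.
Unset Printing Implicit Defensive.

Import Order.TTheory GRing.Theory Num.Theory.
Local Open Scope ring_scope.
Local Open Scope quotient_scope.

(* The function field k(P^1) = k(x). *)
Notation ratfun k := {fraction {poly k}}.

(* k-points of P^1: [Some a] is x = a, [None] is the pole of x. *)
Notation P1 k := (option k).

Local Notation "x %:F" := (tofrac x).

Section Forms.

Variable k : fieldType.
Implicit Types (f g : ratfun k) (P : P1 k).

(* d/dx on k(x), by the quotient rule; [repr f] is a chosen fraction n/d
   representing f, and [ratderiv_frac] shows that the choice is irrelevant. *)
Definition ratderiv f : ratfun k :=
  let: n := \n_(repr f) in
  let: d := \d_(repr f) in
  (n^`() * d - n * d^`())%:F / (d ^+ 2)%:F.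

(* Order of vanishing of f != 0 at P (negative at poles). *)
Definition ord_fun P f : int :=
  let: n := \n_(repr f) in
  let: d := \d_(repr f) in
  if P is Some a then (mup a n)%:Z - (mup a d)%:Z
  else (size d)%:Z - (size n)%:Z.

(* Rational differential forms on P^1 form the k(x)-line k(x) dx: throughout,
   g : ratfun k stands for the form g dx. *)

(* df / f = (f' / f) dx *)
Definition logarithmic g : Prop :=
  exists2 f, f != 0 & g = ratderiv f / f.

(* Order at P of the nonzero form g dx. The local parameter is x - a at a, with
   dx = d(x - a), and t = 1/x at the pole of x, with dx = - t^-2 dt. *)
Definition ord_form P g : int :=
  if P is Some _ then ord_fun P g else ord_fun P g - 2%:Z.

(* The divisor of zeros of g dx is (m - 1) P; for m = 1 there is no zero. *)
Definition only_zero P (m : nat) g : Prop :=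
  ord_form P g = m%:Z - 1 /\ (forall Q, Q != P -> ord_form Q g <= 0).

(* The F_p-linear combination of w with coefficients c, where k has
   characteristic p; c i : 'F_p acts through its representative in nat. *)
Definition Fp_comb (p n : nat) (w : 'I_n -> ratfun k) (c : 'I_n -> 'F_p) :
  ratfun k := \sum_i w i *+ c i.

Definition Fp_space_of_dim (p n : nat) (V : ratfun k -> Prop) : Prop :=
  exists w : 'I_n -> ratfun k,
    (forall c : 'I_n -> 'F_p, Fp_comb w c = 0 -> forall i, c i = 0) /\
    (forall g, V g <-> exists c : 'I_n -> 'F_p, g = Fp_comb w c).

(* V is an L_{m+1,n}, with respect to the point P. *)
Definition is_L (p : nat) P (m n : nat) (V : ratfun k -> Prop) : Prop :=
  [/\ Fp_space_of_dim p n V,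
      forall g, V g -> logarithmic g
    & forall g, V g -> g != 0 -> only_zero P m g].

Lemma mul_repr_denom f : f * (\d_(repr f))%:F = (\n_(repr f))%:F.
Proof.
rewrite -{1}[f]reprK; have := denom_ratioP (repr f).
move: (repr f) => r r0; unlock FracField.tofrac.
rewrite -[LHS]FracField.pi_mul /FracField.mulf !numden_Ratio ?oner_neq0 //.
apply/eqmodP; rewrite /= FracField.equivfE !numden_Ratio ?oner_neq0 ?mulr1 //.
by rewrite mulrC.
Qed.

Lemma repr_frac (n d : {poly k}) : d != 0 ->
  \n_(repr (n%:F / d%:F)) * d = n * \d_(repr (n%:F / d%:F)).
Proof.
move=> d0; apply/eqP; rewrite -tofrac_eq !tofracM -mul_repr_denom.
by rewrite mulrAC divfK // tofrac_eq0.
Qed.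

Lemma ratderiv_frac (n d : {poly k}) : d != 0 ->
  ratderiv (n%:F / d%:F) = (n^`() * d - n * d^`())%:F / (d ^+ 2)%:F.
Proof.
move=> d0; rewrite /ratderiv; have := repr_frac n d0.
have := denom_ratioP (repr (n%:F / d%:F)).
set N := \n_ _; set D := \d_ _ => D0 E.
apply/eqP; rewrite eqr_div ?tofrac_eq0 ?expf_neq0 // -!tofracM tofrac_eq.
have := congr1 (@deriv k) E; rewrite !derivM => E'.
apply/eqP; apply: (mulIf (mulf_neq0 d0 D0)).
have e1 : N^`() * d = n^`() * D + n * D^`() - N * d^`() by rewrite -E' addrK.
transitivity ((N^`() * d) * D ^+ 2 * d ^+ 2 - (N * d) * D^`() * d ^+ 2 * D);
  first by ring.
rewrite e1 E.
transitivity (n^`() * D ^+ 3 * d ^+ 2 - (N * d) * d^`() * D ^+ 2 * d);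
  first by ring.
by rewrite E; ring.
Qed.

Lemma ord_fun_frac P (n d : {poly k}) : n != 0 -> d != 0 ->
  ord_fun P (n%:F / d%:F) =
  if P is Some a then (mup a n)%:Z - (mup a d)%:Z else (size d)%:Z - (size n)%:Z.
Proof.
move=> n0 d0; rewrite /ord_fun; have := repr_frac n d0.
have := denom_ratioP (repr (n%:F / d%:F)).
set N := \n_ _; set D := \d_ _ => D0 E.
have N0 : N != 0.
  by apply: contraNneq (mulf_neq0 n0 D0) => N0; rewrite -E N0 mul0r.
case: P => [a|].
  by have := congr1 (mup a) E; rewrite !mupM //; lia.
have arith (a b c e : nat) : (0 < a)%N -> (0 < b)%N -> (0 < c)%N -> (0 < e)%N ->
  (a + b).-1 = (c + e).-1 -> e%:Z - a%:Z = b%:Z - c%:Z by lia.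
have := congr1 (fun q : {poly k} => size q) E; rewrite /= !size_mul //.
by apply: arith; rewrite size_poly_gt0.
Qed.

End Forms.

(* Main.v *)
(* Move the common zero to the pole of x, and let dx/P0, dx/P1 span the space.
   With l = (m+1)/p, the poles fall into p+1 classes of l points, one for each
   F_p-line of forms, namely the poles which the forms on that line avoid. So,
   up to a constant,
     dx/P0 = A dx/D,   dx/P1 = B dx/D,   D = A B^p - A^p B,
   with A, B coprime such that all their nonzero F_p-combinations have degree l.
   With partial = d/dx, a logarithmic form dx/P satisfies
   partial^(p-1) P^(p-1) = -1 (it is fixed by the Cartier operator).
   Let E = B - t A be the combination over k of degree e < l, and put al = A^p,
   th = d al + E^p with d = t^p - t. Then D = th A - al E, where th and al have
   zero derivative, and expanding D^(p-1) turns the criterion into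
     sum_(j < p-1) th^(p-2-j) al^j M_j = u,
     M_j = partial^(p-1) (A^(p-1-j) E^(j+1)),   u a nonzero constant.
   - If e = l-1, the term j = 0 alone has the top degree.
   - If e = 0, then M_(p-2) = 0 (by degree if l < p-1, by inspection of the
     coefficients if l = p = 3), so th divides u.
   - If l = 3 and e = 1, replacing each th^(p-2-j) by (d al)^(p-2-j) turns the
     sum into al^(p-2) Q and changes it by a multiple of E^p of degree less than
     deg al^(p-2). Hence Q = 0 and E^p divides u.
   Only l = 2, p = 3 escapes; there t^3 = t - 1, A = x^2 - 1, B = t A + 1. *)
Require Import Defs.
From HB Require Import structures.
From mathcomp Require Import all_boot all_order all_algebra.
From mathcomp Require Import ring zify.

Set Implicit Arguments.
Unset Strict Implicit.
Unset Printing Implicit Defensive.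

Import GRing.Theory.
Local Open Scope ring_scope.

Local Notation "x %:F" := (tofrac x).

(** * Logarithmic forms and the Cartier operator *)

Section CharP.

Variables (k : closedFieldType) (p : nat).
Hypothesis hp : p \in [pchar k].
Implicit Types (f g A B E F P Q : {poly k}).

Let p_pr : prime p := pcharf_prime hp.
Let p_gt0 : (0 < p)%N := prime_gt0 p_pr.
Let hpP : p \in [pchar {poly k}].
Proof. by rewrite pchar_poly. Qed.

Lemma deriv_expp f : (f ^+ p)^`() = 0.
Proof. by rewrite deriv_exp mulrn_pchar. Qed.

Lemma derivn_mul_const g f n : g^`() = 0 -> (g * f)^`(n) = g * f^`(n).
Proof.
move=> dg; elim: n f => [|n IHn] f; first by rewrite !derivn0.
by rewrite !derivSn derivM dg mul0r add0r IHn.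
Qed.

Lemma fact_pred_pchar : ((p.-1)`!)%:R = -1 :> k.
Proof.
apply/eqP; rewrite -addr_eq0 natr1 -(dvdn_pcharf hp).
by rewrite -Wilson ?prime_gt1.
Qed.

Lemma derivn_XsubC_exp_pred (z : k) : (('X - z%:P) ^+ p.-1)^`(p.-1) = -1.
Proof.
have -> n : (('X - z%:P) ^+ n)^`(n) = (n`!%:R)%:P.
  elim: n => [|n IHn]; first by rewrite expr0 derivn0.
  rewrite derivSn deriv_exp derivXsubC mul1r derivnMn IHn factS.
  by rewrite mulnC mulrnA !polyCMn.
by rewrite fact_pred_pchar polyCN.
Qed.

(** In other words, the Cartier operator fixes dF/F. The roots of F are adjoined one at a time:
    passing from G to (X - z) G produces two terms whose p-th powers behave as constants under
    differentiation. *)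
Lemma derivn_pred_log F : (F ^+ p.-1 * F^`())^`(p.-1) = - F^`() ^+ p.
Proof.
have [r ->] := closed_field_poly_normal F; move: (lead_coef F) => c.
elim: r => [|z r IHr].
  by rewrite big_nil alg_polyC derivC mulr0 linear0 expr0n gtn_eqF ?oppr0.
rewrite big_cons scalerAr; move: (c *: _) IHr => G IHG.
have -> : (('X - z%:P) * G) ^+ p.-1 * (('X - z%:P) * G)^`() =
    G ^+ p * ('X - z%:P) ^+ p.-1 + ('X - z%:P) ^+ p * (G ^+ p.-1 * G^`()).
  by rewrite derivM derivXsubC mul1r exprMn -[in G ^+ p](prednK p_gt0)
    -[in _ ^+ p * _](prednK p_gt0) !exprS; ring.
rewrite derivnD !(derivn_mul_const _ _ (deriv_expp _)) derivn_XsubC_exp_pred IHG.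
rewrite derivM derivXsubC.
rewrite mul1r [in RHS]exprDn_pchar ?(eq_pnat _ (pcharf_eq hpP)) ?pnat_id //.
by rewrite exprMn; ring.
Qed.

(* The form dx / P equals dF / F. *)
Definition dlog_denom P := exists2 F, F != 0 & F = P * F^`().

(** As F = P F', the product F'^p P^(p-1) equals F^(p-1) F'. Then [derivn_pred_log] applies, and
    F'^p, having zero derivative, cancels. *)
Lemma derivn_pred_dlog_denom P : dlog_denom P -> (P ^+ p.-1)^`(p.-1) = -1.
Proof.
case=> F F0 EF.
have dF0 : F^`() != 0 by apply: contraNneq F0 => dF0; rewrite EF dF0 mulr0.
apply: (mulfI (expf_neq0 p dF0)); rewrite -(derivn_mul_const _ _ (deriv_expp _)) mulrN1.
rewrite -derivn_pred_log; congr (_^`(_)).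
by rewrite {2}EF exprMn -[in LHS](prednK p_gt0) exprS; ring.
Qed.

Lemma natr_expp (R : nzSemiRingType) n : p \in [pchar R] -> n%:R ^+ p = n%:R :> R.
Proof. by move=> hR; rewrite -(pFrobenius_autE hR) pFrobenius_aut_nat. Qed.

(* The residue of dF / F at z is the multiplicity of z as a root of F. *)
Lemma dlog_denom_root P z :
  dlog_denom P -> P.[z] = 0 -> exists a : nat, P^`().[z] * a%:R = 1.
Proof.
case=> F F0 EF Pz.
have /factor_theorem[Q EP] : root P z by apply/eqP.
have -> : P^`().[z] = Q.[z].
  by rewrite EP derivM derivXsubC mulr1 !hornerE subrr mulr0 add0r.
have [[|a] [G /implyP/(_ F0) Gz EG]] := multiplicity_XsubC F z.
  by case/negP: Gz; rewrite expr0 mulr1 in EG; rewrite -EG EF rootE hornerM Pz mul0r.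
exists a.+1; apply: (mulIf Gz); rewrite mul1r.
have E : G = Q * (G *+ a.+1 + ('X - z%:P) * G^`()).
  apply: (mulIf (expf_neq0 a.+1 (negbT (polyXsubC_eq0 z)))).
  rewrite -EG {1}EF EG EP derivM deriv_exp derivXsubC mul1r /= exprS.
  rewrite -[in LHS]mulr_natr -[in RHS]mulr_natr.
  by move: (a.+1)%:R => n; set u := ('X - z%:P) ^+ a; set v := 'X - z%:P; ring.
have /= := congr1 (horner^~ z) E.
rewrite hornerM hornerD hornerMn hornerM hornerXsubC subrr mul0r addr0 => E1.
by rewrite [RHS]E1 -[in RHS]mulr_natr mulrA mulrAC.
Qed.

End CharP.

(** * The degree argument *)

(** Multiplied by x - y, both sides become x^p - y^p. When x = y, the sum consists of p equal terms
    and is 0. *)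
Lemma sub_exp_pred (R : idomainType) (p : nat) (x y : R) : p \in [pchar R] ->
  (x - y) ^+ p.-1 = \sum_(i < p) x ^+ (p.-1 - i) * y ^+ i.
Proof.
move=> hR; have p_pr := pcharf_prime hR.
have p_gt1 := prime_gt1 p_pr; have p_gt0 := ltnW p_gt1.
have [->|nxy] := eqVneq x y.
  have p1 : (p.-1 == 0)%N = false by lia.
  rewrite subrr expr0n p1 /=.
  rewrite (eq_bigr (fun=> y ^+ p.-1)) => [|i _].
    by rewrite sumr_const card_ord (mulrn_pchar hR).
  by rewrite -exprD subnK // -ltnS prednK.
have nz : x - y != 0 by rewrite subr_eq0.
apply: (mulfI nz); rewrite -subrXX -exprS prednK //.
by rewrite exprDn_pchar ?exprNn_pchar ?(eq_pnat _ (pcharf_eq hR)) ?pnat_id.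
Qed.

Lemma size_exp_neq0 (R : idomainType) (f : {poly R}) n :
  f != 0 -> size (f ^+ n) = ((size f).-1 * n).+1.
Proof.
by move=> f0; rewrite -size_exp prednK // size_poly_gt0 expf_neq0.
Qed.

Lemma size_derivn_leq (R : nzRingType) (f : {poly R}) n : (size f^`(n) <= size f - n)%N.
Proof.
apply/leq_sizeP => i hi; rewrite coef_derivn nth_default ?mul0rn //.
by rewrite -leq_subLR.
Qed.

Section Degrees.

Variables (k : closedFieldType) (p : nat).
Hypothesis hp : p \in [pchar k].
Implicit Types (A E th al : {poly k}).

Let p_pr : prime p := pcharf_prime hp.
Let p_gt0 : (0 < p)%N := prime_gt0 p_pr.
Let hpP : p \in [pchar {poly k}].
Proof. by rewrite pchar_poly. Qed.

(** The degree of f is -1 modulo p, so the factors that p-1 derivations put on the leading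
    coefficient are -1, ..., -(p-1) modulo p, and none vanishes. *)
Lemma size_derivn_pred (f : {poly k}) l :
  size f = (p * l.+1)%N -> size f^`(p.-1) = (p * l).+1.
Proof.
move=> sf; apply/eqP; rewrite eqn_leq; apply/andP; split.
  by apply: leq_trans (size_derivn_leq _ _) _; rewrite sf mulnS; lia.
rewrite ltnNge; apply/negP => /leq_sizeP/(_ _ (leqnn _))/eqP.
rewrite coef_derivn -mulr_natr mulf_eq0 -(dvdn_pcharf hp).
have -> : (p.-1 + p * l)%N = (size f).-1 by rewrite sf mulnS; lia.
rewrite -lead_coefE lead_coef_eq0 -size_poly_eq0 sf => /orP[/eqP|]; first lia.
rewrite ffact_prod Euclid_dvd_prod // big_has_cond => /hasP[i _].
have ip := ltn_ord i.
rewrite /=; have -> : ((p * l.+1).-1 - i = p * l + (p.-1 - i))%N by lia.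
by rewrite dvdn_addr ?dvdn_mulr // => /dvdn_leq; lia.
Qed.

(** Expand the power by [sub_exp_pred]. The factor A in front turns the first term into al th^(p-1),
    whose derivative is zero. In every other term th^(p-2-j) al^(j+1) comes out of the derivative,
    and one factor al is cancelled at the end. *)
Lemma derivn_pred_expansion (A E : {poly k}) (d u : k)
    (al : {poly k} := A ^+ p) (th : {poly k} := d *: al + E ^+ p) :
  A != 0 ->
  (A * (th * A - al * E) ^+ p.-1)^`(p.-1) = u *: al ->
  \sum_(j < p.-1) th ^+ (p.-2 - j) * al ^+ j *
     (A ^+ (p.-1 - j) * E ^+ j.+1)^`(p.-1) = u%:P.
Proof.
move=> A0; have dal : al^`() = 0 by apply: deriv_expp.
have dth : th^`() = 0 by rewrite derivD derivZ dal deriv_expp // scaler0 addr0.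
have al0 : al != 0 by rewrite expf_neq0.
rewrite sub_exp_pred // -[in \sum_(i < p) _](prednK p_gt0) big_ord_recl /=.
rewrite mulrDr derivnD subn0 expr0 mulr1 exprMn.
have -> : A * (th ^+ p.-1 * A ^+ p.-1) = al * th ^+ p.-1.
  by rewrite mulrCA -exprS prednK // mulrC.
have dn0 : (0 < p.-1)%N by rewrite -ltnS prednK // prime_gt1.
have dexp n : (th ^+ n)^`() = 0 by rewrite deriv_exp dth mul0r mul0rn.
rewrite derivn_mul_const // -(prednK dn0) derivSn dexp linear0 mulr0 add0r.
rewrite prednK // => H; apply: (mulfI al0); rewrite [RHS]mulrC mul_polyC -H !mulr_sumr.
rewrite (big_morph _ (derivnD p.-1) (linear0 _)) /=; apply: eq_bigr => j _.
have dal_exp n : (al ^+ n)^`() = 0 by rewrite deriv_exp dal mul0r mul0rn.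
have jp := ltn_ord j; rewrite /bump /= add1n !exprMn.
have -> : (p.-1 - j = (p.-1 - j.+1).+1)%N by lia.
have -> : (p.-2 - j = p.-1 - j.+1)%N by lia.
transitivity ((th ^+ (p.-1 - j.+1) * al ^+ j.+1 *
    (A ^+ (p.-1 - j.+1).+1 * E ^+ j.+1))^`(p.-1)); last first.
  by congr (_^`(_)); rewrite (exprS A); move: (_ - _)%N => n; clearbody th al; ring.
rewrite [RHS]derivn_mul_const; last by rewrite derivM dexp dal_exp mul0r mulr0 addr0.
by rewrite (exprS al); ring.
Qed.

(** Here A has degree l+1. The product A^(p-1-j) E^(j+1) has degree p (l+1) - 1 - j, so its
    derivative of order p-1 has degree at most p l - j, with equality for j = 0 by
    [size_derivn_pred]. All th^(p-2-j) al^j have the same degree, so the term j = 0 dominates. *)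
Lemma no_pencil_codeg1 (l : nat) (A E : {poly k}) (th al : {poly k}) (u : k) :
  (2 < p)%N -> size A = l.+2 -> size E = l.+1 ->
  size th = (p * l.+1).+1 -> size al = (p * l.+1).+1 ->
  \sum_(j < p.-1) th ^+ (p.-2 - j) * al ^+ j *
     (A ^+ (p.-1 - j) * E ^+ j.+1)^`(p.-1) = u%:P -> False.
Proof.
move=> p2 sA sE sth sal.
have A0 : A != 0 by rewrite -size_poly_gt0 sA.
have E0 : E != 0 by rewrite -size_poly_gt0 sE.
have th0 : th != 0 by rewrite -size_poly_gt0 sth.
have al0 : al != 0 by rewrite -size_poly_gt0 sal.
have p1 : (0 < p.-1)%N by lia.
rewrite (bigD1 (Ordinal p1)) //= [(p.-2 - 0)%N]subn0 expr0 mulr1 expr1.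
set f := _ * _; set g := \sum_(i < _ | _) _ => /(congr1 (fun q : {poly k} => size q)).
have sf : size f = (p * l.+1 * p.-2 + p * l).+1.
  have sM : size (A ^+ (p.-1 - 0) * E)^`(p.-1) = (p * l).+1.
    apply: size_derivn_pred.
    by rewrite subn0 size_mul ?expf_neq0 // size_exp_neq0 // sA sE /=; lia.
  have M0 : (A ^+ (p.-1 - 0) * E)^`(p.-1) != 0 by rewrite -size_poly_gt0 sM.
  by rewrite size_mul ?expf_neq0 // sM size_exp_neq0 // sth /=; lia.
have sg : (size g < size f)%N.
  rewrite sf ltnS; apply: leq_trans (size_sum _ _ _) _; apply/bigmax_leqP => j jn0.
  have j0 : (0 < j)%N by rewrite lt0n; apply: contraNneq jn0 => j0; apply/eqP/val_inj.
  have jp := ltn_ord j.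
  apply: leq_trans (size_polyMleq _ _) _.
  rewrite size_mul ?expf_neq0 // !size_exp_neq0 // sth sal.
  have := size_derivn_leq (A ^+ (p.-1 - j) * E ^+ j.+1) p.-1.
  rewrite size_mul ?expf_neq0 // !size_exp_neq0 // sA sE /=.
  set s := (size (polyseq (_^`(_)))); move: s (nat_of_ord j) j0 jp => s i i0 ip.
  have [a ->] : exists a, p = (a + i).+2 by exists (p - i - 2)%N; lia.
  have -> : ((a + i).+2.-1 - i = a.+1)%N by lia.
  have -> : ((a + i).+2.-2 - i = a)%N by lia.
  rewrite /= => hs.
  have {}hs : (s <= (a + i).+2 * l)%N by nia.
  nia.
have N0 : (0 < p * l.+1 * p.-2)%N by rewrite !muln_gt0 p_gt0 /=; lia.
by rewrite size_polyDl // sf; have := size_polyC_leq1 u; lia.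
Qed.

(** Every term but the last, j = p-2, contains a positive power of [th], and the last one is zero;
    but a nonconstant [th] cannot divide u. *)
Lemma no_pencil_last0 A E th al (u : k) :
  (1 < size th)%N -> u != 0 -> (A * E ^+ p.-1)^`(p.-1) = 0 ->
  \sum_(j < p.-1) th ^+ (p.-2 - j) * al ^+ j *
     (A ^+ (p.-1 - j) * E ^+ j.+1)^`(p.-1) = u%:P -> False.
Proof.
move=> sth u0 M0 S; have : th %| u%:P.
  rewrite -S; apply: (big_ind (fun f => th %| f)) => [|f g|j _];
    [exact: dvdp0 | exact: dvdp_add |].
  have [jp|jp] := ltnP j p.-2.
    by rewrite -mulrA dvdp_mulr // -[(_ - j)%N]prednK ?subn_gt0 // exprS dvdp_mulr.
  have [-> ->] : (p.-1 - j = 1)%N /\ (j.+1 = p.-1)%N by have := ltn_ord j; lia.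
  by rewrite expr1 M0 mulr0 dvdp0.
move/dvdp_leq; rewrite polyC_eq0 u0 size_polyC u0 => /(_ isT).
by rewrite leqNgt sth.
Qed.

Lemma no_pencil_deg_3_1 A E th al (d u : k) :
  (2 < p)%N -> size A = 4%N -> size E = 2%N -> d != 0 -> u != 0 ->
  al = A ^+ p -> th = d *: al + E ^+ p -> size th = (p * 3).+1 ->
  \sum_(j < p.-1) th ^+ (p.-2 - j) * al ^+ j *
     (A ^+ (p.-1 - j) * E ^+ j.+1)^`(p.-1) = u%:P -> False.
Proof.
move=> p2 sA sE d0 u0 Eal Eth sth S.
have A0 : A != 0 by rewrite -size_poly_gt0 sA.
have E0 : E != 0 by rewrite -size_poly_gt0 sE.
have th0 : th != 0 by rewrite -size_poly_gt0 sth.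
have al0 : al != 0 by rewrite Eal expf_neq0.
have sal : size al = (p * 3).+1 by rewrite Eal size_exp_neq0 // sA mulnC.
set M := fun j : nat => (A ^+ (p.-1 - j) * E ^+ j.+1)^`(p.-1).
have sM j : (j < p.-1)%N -> (size (M j) <= 2 * p)%N.
  move=> jp; apply: leq_trans (size_derivn_leq _ _) _.
  by rewrite size_mul ?expf_neq0 // !size_exp_neq0 // sA sE /=; lia.
(* [Q] is what remains, after division by al^(p-2), when every power of [th] is replaced by that of
   d al; [R] is the error made. *)
pose Q := \sum_(j < p.-1) d ^+ (p.-2 - j) *: M j.
pose R := \sum_(j < p.-1) (th ^+ (p.-2 - j) - (d *: al) ^+ (p.-2 - j)) * al ^+ j * M j.
have EEp : th - d *: al = E ^+ p by rewrite Eth addrAC subrr add0r.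
have EQR : al ^+ p.-2 * Q + R = u%:P.
  rewrite -S /Q /R mulr_sumr -big_split /=; apply: eq_bigr => j _.
  have -> : al ^+ p.-2 = al ^+ (p.-2 - j) * al ^+ j.
    by rewrite -exprD subnK //; have := ltn_ord j; lia.
  rewrite -/(M j) exprZn -!mul_polyC; move: (M j) (p.-2 - j)%N => f n; ring.
have dvR : E ^+ p %| R.
  apply: (big_ind (fun f => E ^+ p %| f)) => [|f g|j _]; [exact: dvdp0 | exact: dvdp_add |].
  rewrite -mulrA dvdp_mulr // subrXX dvdp_mulr //.
  by rewrite EEp dvdpp.
(* The degrees of E^p, [K], al^j and M_j add up to at most p + 3p(p-3-j) + 3pj + 2p - 1 = 3p(p-2) -
   1. For j = p-2 the difference of powers is 1 - 1 = 0. *)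
have sR : (size R <= 3 * p * p.-2)%N.
  apply: leq_trans (size_sum _ _ _) _; apply/bigmax_leqP => j _.
  have jp := ltn_ord j.
  have [jp2|jp2] := ltnP j p.-2; last first.
    by rewrite (eqP (_ : p.-2 - j == 0)%N) // ?expr0 ?subrr ?mul0r ?size_poly0.
  rewrite subrXX EEp -!mulrA; set K := \sum_(i < _) _.
  have sK : (size K <= (3 * p * (p.-2 - j).-1).+1)%N.
    apply: leq_trans (size_sum _ _ _) _; apply/bigmax_leqP => i _.
    apply: leq_trans (size_polyMleq _ _) _.
    rewrite !size_exp_neq0 ?scaler_eq0 ?negb_or ?d0 // size_scale // sth sal /=.
    have := ltn_ord i; clear; nia.
  apply: leq_trans (size_polyMleq _ _) _.
  rewrite size_exp_neq0 // sE /=.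
  have := size_polyMleq K (al ^+ j * M j); have := size_polyMleq (al ^+ j) (M j).
  rewrite size_exp_neq0 // sal /=; have := sM j jp.
  move: (size (M j)) (size (_ * M j)) (size (K * _)) (size K) sK => a b c e.
  have [n En] : exists n, p.-2 = (n + j).+1 by exists (p.-2 - j.+1)%N; lia.
  rewrite En (_ : (_.+1 - j).-1 = n)%N; last by lia.
  by move: (nat_of_ord j) => i; rewrite -[(3 * p)%N]mulnC -!mulnA; nia.
(* Otherwise al^(p-2) Q, of degree at least 3p(p-2), would exceed [R] in degree, and the sum would
   not be constant. *)
have Q0 : Q = 0.
  have [//|Qn0] := eqVneq Q 0.
  have sQ : (3 * p * p.-2 < size (al ^+ p.-2 * Q)%R)%N.
    rewrite size_mul ?expf_neq0 // size_exp_neq0 // sal /=.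
    by rewrite [(p * 3)%N]mulnC -addn1 leq_add2l size_poly_gt0.
  have := congr1 (fun q : {poly k} => size q) EQR.
  rewrite size_polyDl; last exact: leq_ltn_trans sR sQ.
  by rewrite size_polyC u0 => E1; move: sQ; rewrite E1 ltnS leqn0 !muln_eq0; clear -p2; lia.
move: dvR EQR; rewrite Q0 mulr0 add0r => /[swap] -> /dvdp_leq.
by rewrite polyC_eq0 u0 size_polyC u0 size_exp_neq0 // sE => /(_ isT); lia.
Qed.

(** With E = e the relation reads A^3 (d e (A^2)'' + e^2 A'') + e^4 (A^2)'' = u. As (A^2)'' has
    degree at most 4, the bracket vanishes. Its coefficient of X^3 gives A_2 A_3 = 0, hence A_2 = 0
    and A'' = 2 A_2 + 6 A_3 X = 0. *)
Lemma derivn_last_char3 A E al (d u : k) :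
  p = 3%N -> size A = 4%N -> size E = 1%N -> d != 0 -> al = A ^+ p ->
  \sum_(j < p.-1) (d *: al + E ^+ p) ^+ (p.-2 - j) * al ^+ j *
     (A ^+ (p.-1 - j) * E ^+ j.+1)^`(p.-1) = u%:P ->
  (A * E ^+ p.-1)^`(p.-1) = 0.
Proof.
move=> p3 sA /eqP/size_poly1P[e e0 ->] d0 ->; move: hp; rewrite p3 => hp3 /=.
rewrite big_ord_recr big_ord1 /= !subn0 !expr0 !expr1 !mulr1 mul1r -!rmorphXn /=.
have A0 : A != 0 by rewrite -size_poly_gt0 sA.
have ddC (f : {poly k}) (c : k) : (f * c%:P)^`()^`() = c *: f^`()^`().
  by rewrite mulrC mul_polyC !derivZ.
rewrite !ddC; set M0 := (A ^+ 2)^`()^`(); set M1 := A^`()^`() => S.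
have sM0 : (size M0 <= 5)%N.
  by apply: leq_trans (size_derivn_leq (A ^+ 2) 2) _; rewrite size_exp_neq0 // sA.
have sM1 : (size M1 <= 2)%N.
  by apply: leq_trans (size_derivn_leq A 2) _; rewrite sA.
have M01 : (d * e) *: M0 + e ^+ 2 *: M1 = 0.
  have [//|n0] := eqVneq ((d * e) *: M0 + e ^+ 2 *: M1) 0.
  have EP : A ^+ 3 * ((d * e) *: M0 + e ^+ 2 *: M1) + e ^+ 3 *: (e *: M0) = u%:P.
    by rewrite -S -!mul_polyC !polyCM; ring.
  have := congr1 (fun q : {poly k} => size q) EP.
  have sN : size (A ^+ 3 * ((d * e) *: M0 + e ^+ 2 *: M1)) =
      (9 + size ((d * e) *: M0 + e ^+ 2 *: M1)%R)%N.
    by rewrite size_mul ?expf_neq0 // size_exp_neq0 // sA.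
  have := size_polyC_leq1 u; rewrite -size_poly_gt0 in n0.
  have sr : (size (e ^+ 3 *: (e *: M0)) <= 5)%N.
    by rewrite scalerA (leq_trans (size_scale_leq _ _)).
  by rewrite size_polyDl; rewrite sN; lia.
have c5 : (A ^+ 2)`_5 = A`_2 * A`_3 *+ 2.
  rewrite expr2 coefM !big_ord_recr big_ord0 /=.
  by rewrite [A`_4]nth_default ?[A`_5]nth_default ?sA //; ring.
have a3 : A`_3 != 0 by have := lead_coef_eq0 A; rewrite lead_coefE sA /= (negbTE A0) => ->.
have h3 : 3%:R = 0 :> k := pcharf0 hp3.
have A2 : A`_2 = 0.
  have := congr1 (fun f : {poly k} => f`_3) M01.
  rewrite coefD !coefZ [M1`_3]nth_default ?(leq_trans sM1) //.
  rewrite !coef_deriv c5 mulr0 addr0 coef0 => /eqP.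
  have -> : A`_2 * A`_3 *+ 2 *+ 5 *+ 4 = A`_2 * A`_3 + A`_2 * A`_3 * 13%:R * 3%:R by ring.
  by rewrite h3 mulr0 addr0 !mulf_eq0 (negbTE e0) (negbTE d0) (negbTE a3) /= orbF => /eqP.
suff -> : M1 = 0 by rewrite scaler0.
  apply/polyP => -[|[|i]]; rewrite coef0 ?[M1`_i.+2]nth_default ?(leq_trans sM1) //.
    by rewrite !coef_deriv A2 !mul0rn.
  by rewrite !coef_deriv -mulrnA -mulr_natr natrM h3 mul0r mulr0.
Qed.

Lemma no_pencil (l : nat) A E (d u : k) :
  (2 < p)%N -> (0 < l <= 3)%N -> ~~ ((l == 2) && (p == 3))%N ->
  size A = l.+1 -> E != 0 -> (size E <= l)%N -> d != 0 -> u != 0 ->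
  (A * ((d *: A ^+ p + E ^+ p) * A - A ^+ p * E) ^+ p.-1)^`(p.-1) = u *: A ^+ p ->
  False.
Proof.
move=> p2 /andP[l0 l3] lp sA E0 sE d0 u0 H.
have A0 : A != 0 by rewrite -size_poly_gt0 sA.
have := derivn_pred_expansion A0 H; set th := _ + _.
have sal : size (A ^+ p) = (p * l).+1 by rewrite size_exp_neq0 // sA mulnC.
have sth : size th = (p * l).+1.
  rewrite size_polyDl size_scale // sal // size_exp_neq0 // ltnS mulnC ltn_pmul2l //.
  by rewrite prednK // size_poly_gt0.
have sth1 : (1 < size th)%N by rewrite sth ltnS muln_gt0 p_gt0.
have {}sE : [\/ size E = l, size E = 1%N /\ l != 1%N | size E = 2%N /\ l = 3%N].
  move: sE; rewrite -size_poly_gt0 in E0; case: (size E) E0 => [|[|[|[|s]]]] // _ sE.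
  - by have [->|] := eqVneq l 1%N; [constructor 1|constructor 2].
  - by move: sE; case: l l3 {l0 lp sA sal sth} => [|[|[|[|]]]] // _ _;
      [constructor 1|constructor 3].
  - by constructor 1; lia.
  - by lia.
move=> S; case: sE => [sE|[sE l1]|[sE El]].
- case: l l0 sA sE sal sth {l3 lp} => // l _ sA sE sal sth.
  exact: (no_pencil_codeg1 p2 sA sE sth sal S).
- apply: (no_pencil_last0 sth1 u0 _ S).
  have [lp1|lp1] := ltnP l p.-1.
    move/eqP/size_poly1P: sE => [e e0 ->].
    rewrite -rmorphXn /= mulrC mul_polyC derivnZ.
    suff -> : A^`(p.-1) = 0 by rewrite scaler0.
    apply/eqP; rewrite -size_poly_eq0 -leqn0; apply: leq_trans (size_derivn_leq _ _) _.
    by rewrite sA leqn0 subn_eq0.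
  (* Here p - 1 <= l <= 3; p = 4 is not prime, and l = 2 with p = 3 is excluded by [lp]. *)
  have [l3' p3] : l = 3%N /\ p = 3%N.
    have p4 : p != 4%N by apply: contraTneq p_pr => ->.
    by move: lp; clear -p2 l0 l1 l3 lp1 p4; lia.
  rewrite l3' in sA.
  exact: (derivn_last_char3 p3 sA sE d0 erefl S).
- rewrite El in sA sth; exact: (no_pencil_deg_3_1 p2 sA sE d0 u0 erefl erefl sth S).
Qed.

End Degrees.

(** * Pencils of logarithmic forms *)

Section Pencil.

(** Evaluate X^p - X, the product of the X + i over i < p, at b/a and multiply by a^p. The case a =
    0 is separate. *)
Lemma prod_addMn_pchar (F : fieldType) (p : nat) (a b : F) : p \in [pchar F] ->
  \prod_(i < p) (b + a *+ i) = b ^+ p - a ^+ p.-1 * b.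
Proof.
move=> hp; have p_pr := pcharf_prime hp; have p1 := prime_gt1 p_pr.
have [->|a0] := eqVneq a 0.
  rewrite (eq_bigr (fun=> b)) => [|i _]; last by rewrite mul0rn addr0.
  by rewrite prodr_const card_ord expr0n (_ : p.-1 == 0 = false)%N ?mul0r ?subr0 //; lia.
pose rs : seq F := [seq - i%:R | i <- iota 0 p].
have sz : size ('X^p - 'X : {poly F}) = p.+1.
  by rewrite size_polyDl size_polyXn // size_polyN size_polyX.
have E : 'X^p - 'X = \prod_(z <- rs) ('X - z%:P).
  rewrite [LHS](@all_roots_prod_XsubC _ _ rs) ?sz ?size_map ?size_iota //.
  - rewrite (_ : lead_coef _ = 1) ?scale1r // lead_coefDl ?lead_coefXn //.
    by rewrite size_polyN size_polyX size_polyXn.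
  - apply/allP => _ /mapP[i _ ->]; rewrite rootE !hornerE exprNn_pchar; last first.
      by rewrite (eq_pnat _ (pcharf_eq hp)) pnat_id.
    by rewrite natr_expp // subrr.
  rewrite uniq_rootsE map_inj_in_uniq ?iota_uniq // => i j.
  rewrite !mem_iota !add0n /= => ip jp /oppr_inj/eqP.
  wlog le_ij : i j ip jp / (i <= j)%N.
    by move=> W; have [/W|/ltnW/W W'] := leqP i j; [exact | rewrite eq_sym => /W' ->].
  rewrite eq_sym -subr_eq0 -natrB // -(dvdn_pcharf hp) => /dvdn_leq; lia.
have := congr1 (horner^~ (b / a)) E.
rewrite horner_prod big_map hornerD hornerN hornerXn hornerX.
rewrite (_ : iota 0 p = index_iota 0 p) ?big_mkord => [Eab|]; last first.
  by rewrite /index_iota subn0.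
have ab : a * (b / a) = b by rewrite mulrC divfK.
transitivity (a ^+ p * ((b / a) ^+ p - b / a)).
  rewrite Eab -[in a ^+ p](card_ord p) -prodr_const -big_split /=.
  by apply: eq_bigr => i _; rewrite hornerXsubC opprK mulrDr ab mulr_natr.
by rewrite mulrBr -exprMn ab -[in a ^+ p * _](prednK (ltnW p1)) exprSr -mulrA ab.
Qed.

Lemma prod_addMn_poly_pchar (k : fieldType) (p : nat) (A B : {poly k}) : p \in [pchar k] ->
  \prod_(i < p) (B + A *+ i) = B ^+ p - A ^+ p.-1 * B.
Proof.
move=> hp; apply/eqP; rewrite -tofrac_eq rmorph_prod tofracB tofracM !tofracXn.
rewrite -prod_addMn_pchar; last by rewrite (rmorph_pchar (@tofrac {poly k})) ?pchar_poly.
by apply/eqP/eq_bigr => i _; rewrite /= rmorphD rmorphMn.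
Qed.

Lemma dvdp_prod_coprime (k : fieldType) (I : eqType) (r : seq I) (F : I -> {poly k}) G :
  uniq r -> {in r &, forall i j, i != j -> coprimep (F i) (F j)} ->
  {in r, forall i, F i %| G} -> \prod_(i <- r) F i %| G.
Proof.
elim: r => [|i r IHr] /=; first by rewrite big_nil dvd1p.
case/andP=> ir ur cF dF; rewrite big_cons Gauss_dvdp.
  rewrite dF ?mem_head // IHr // => [j l jr lr|j jr].
    by apply: cF; rewrite in_cons ?jr ?lr orbT.
  by rewrite dF // in_cons jr orbT.
rewrite coprimep_sym big_seq; apply: (big_ind (fun f => coprimep f (F i))) => [|f g|j jr].
- by rewrite coprimep_sym coprimep1.
- by move=> cf cg; rewrite coprimepMl cf.
- apply: cF; rewrite ?mem_head ?in_cons ?jr ?orbT //.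
  by apply: contraNneq ir => <-.
Qed.

End Pencil.

(** * The common shape of the two denominators of a pencil *)

Section PencilForm.

Variables (k : closedFieldType) (p : nat).
Hypothesis hp : p \in [pchar k].

Let p_pr : prime p := pcharf_prime hp.
Let p_gt0 : (0 < p)%N := prime_gt0 p_pr.
Let p_gt1 : (1 < p)%N := prime_gt1 p_pr.
Implicit Types (A B Q P : {poly k}).

(* Every nonzero F_p-combination i dx / P0 + j dx / P1 is a logarithmic form
   dx / Q with Q of degree n. *)
Definition log_pencil (n : nat) P0 P1 := forall i j : nat,
  ~~ (p %| i)%N || ~~ (p %| j)%N ->
  exists Q : {poly k}, [/\ size Q = n.+1, dlog_denom Q & (P1 *+ i + P0 *+ j) * Q = P0 * P1].

(** Cancelling the gcd, P0 = B G and P1 = A G, turns the pencil relation into (i A + j B) Q = A B G.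
    All Q have the same degree, hence so do all i A + j B. The B + i A with 0 < i < p are prime to A
    B and to each other, so their product divides G; the quotient is C. *)
Lemma log_pencil_form n P0 P1 : P0 != 0 -> P1 != 0 -> log_pencil n P0 P1 ->
  exists A B (C : {poly k}),
    [/\ [/\ coprimep A B, P0 = C * (B ^+ p - A ^+ p.-1 * B) & P1 * B = P0 * A],
        C != 0 &
        forall i j : nat, ~~ (p %| i)%N || ~~ (p %| j)%N ->
          A *+ i + B *+ j != 0 /\ size (A *+ i + B *+ j) = size A].
Proof.
move=> P0n0 P1n0 H; pose G := gcdp P0 P1; pose B := P0 %/ G; pose A := P1 %/ G.
have G0 : G != 0 by rewrite gcdp_eq0 negb_and P0n0.
have EP0 : P0 = B * G by rewrite divpK ?dvdp_gcdl.
have EP1 : P1 = A * G by rewrite divpK ?dvdp_gcdr.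
have cAB : coprimep A B by rewrite coprimep_sym coprimep_div_gcd // P0n0.
move: (A : {poly k}) (B : {poly k}) (G : {poly k}) G0 EP0 EP1 cAB.
move=> {}A {}B {}G G0 EP0 EP1 cAB.
have A0 : A != 0 by apply: contraNneq P1n0 => A0; rewrite EP1 A0 mul0r.
have B0 : B != 0 by apply: contraNneq P0n0 => B0; rewrite EP0 B0 mul0r.
have HQ i j : ~~ (p %| i)%N || ~~ (p %| j)%N ->
    exists2 Q : {poly k}, size Q = n.+1 & (A *+ i + B *+ j) * Q = A * B * G.
  move=> /H[Q [sQ _ EQ]]; exists Q => //; apply: (mulfI G0).
  transitivity (P0 * P1); last by rewrite EP0 EP1; ring.
  by rewrite -EQ EP0 EP1; ring.
have ABG0 : A * B * G != 0 by rewrite !mulf_neq0.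
have N0 i j : ~~ (p %| i)%N || ~~ (p %| j)%N -> A *+ i + B *+ j != 0.
  by move=> /HQ[Q _ EQ]; apply: contraNneq ABG0 => N0; rewrite -EQ N0 mul0r.
have sN i j : ~~ (p %| i)%N || ~~ (p %| j)%N ->
    (size (A *+ i + B *+ j)%R + n)%N = size (A * B * G).
  move=> pij; have [Q sQ EQ] := HQ i j pij.
  have Q0 : Q != 0 by rewrite -size_poly_gt0 sQ.
  by rewrite -EQ size_mul ?N0 // sQ addnS.
have p1 : ~~ (p %| 1)%N by rewrite dvdn1 gtn_eqF.
have sN' i j : ~~ (p %| i)%N || ~~ (p %| j)%N -> size (A *+ i + B *+ j) = size A.
  move=> pij; have := sN i j pij; have := sN 1%N 0%N; rewrite p1 mulr0n addr0 mulr1n.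
  by move=> <- // /eqP; rewrite eqn_add2r => /eqP.
have nAB x : B.[x] = 0 -> A.[x] = 0 -> False.
  by move=> /eqP Bx Ax; have := coprimep_root (etrans (coprimep_sym B A) cAB) Bx;
    rewrite Ax eqxx.
have nz (i : nat) : ~~ (p %| i)%N -> i%:R != 0 :> k by rewrite (dvdn_pcharf hp).
have hN (i : nat) x : (B + A *+ i).[x] = B.[x] + A.[x] * i%:R.
  by rewrite hornerD hornerMn mulr_natr.
have dvS : \prod_(1 <= i < p) (B + A *+ i) %| G.
  apply: dvdp_prod_coprime; first exact: iota_uniq.
    move=> i j; rewrite !mem_index_iota => ip jp nij.
    apply/Pdiv.ClosedField.coprimepP => x; rewrite rootE !hN => /eqP Nx; apply/eqP => Nx'.
    wlog lt_ij : i j ip jp nij Nx Nx' / (i < j)%N.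
      move=> W; have [lt_ij|lt_ji|eq_ij] := ltngtP i j; first exact: (W i j).
        by apply: (W j i) => //; rewrite eq_sym.
      by rewrite eq_ij eqxx in nij.
    have /nz pij : ~~ (p %| j - i)%N
      by rewrite gtnNdvd ?subn_gt0 // (leq_ltn_trans (leq_subr _ _)) //; case/andP: jp.
    have /eqP : A.[x] * (j - i)%:R = 0.
      rewrite natrB 1?ltnW // -[RHS](subrr (0 : k)) -{1}Nx' -Nx; ring.
    rewrite mulf_eq0 (negbTE pij) orbF => /eqP Ax; apply: (nAB x) => //.
    by rewrite -Nx Ax mul0r addr0.
  move=> i; rewrite mem_index_iota => ip.
  have pi : ~~ (p %| i)%N by rewrite gtnNdvd //; case/andP: ip.
  have [Q _ EQ] := HQ i 1%N (introT orP (or_introl pi)).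
  have cN : coprimep (B + A *+ i) (A * B).
    apply/Pdiv.ClosedField.coprimepP => x; rewrite rootE hN => /eqP Nx.
    rewrite hornerM mulf_eq0; apply/norP; split; apply/eqP => Zx.
      by apply: (nAB x) => //; rewrite -Nx Zx mul0r addr0.
    apply: (nAB x) => //; apply: (mulIf (nz i pi)).
    by rewrite mul0r -Nx Zx add0r.
  by rewrite -(Gauss_dvdpr _ cN) -EQ addrC mulr1n dvdp_mulr.
have [C EC] := dvdpP _ _ dvS.
have EBS : B * \prod_(1 <= i < p) (B + A *+ i) = B ^+ p - A ^+ p.-1 * B.
  rewrite -prod_addMn_poly_pchar // -(big_mkord xpredT (fun i => B + A *+ i)).
  by rewrite [RHS]big_ltn //= mulr0n addr0.
exists A, B, C; split; last by move=> i j pij; split; [exact: N0 | exact: sN'].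
  by split=> //; [rewrite EP0 EC -EBS; ring | rewrite EP0 EP1; ring].
by apply: contraNneq G0 => C0; rewrite EC C0 mul0r.
Qed.

End PencilForm.

(** * Simple disjoint poles, and the reduction of a pencil to the degree argument *)

Section NoLogPencil.

Variables (k : closedFieldType) (p : nat).
Hypothesis hp : p \in [pchar k].

Let p_pr : prime p := pcharf_prime hp.
Let p_gt0 : (0 < p)%N := prime_gt0 p_pr.
Let p_gt1 : (1 < p)%N := prime_gt1 p_pr.
Let hpP : p \in [pchar {poly k}].
Proof. by rewrite pchar_poly. Qed.
Implicit Types (A B Q P : {poly k}).

(** By [prod_addMn_pchar] with a = 1 and b = -x, the product of the i - x over i < p is 0. *)
Lemma expp_eq_nat (x : k) : x ^+ p = x -> exists2 i : nat, (i < p)%N & x = i%:R.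
Proof.
move=> xp; have := prod_addMn_pchar 1 (- x) hp.
rewrite exprNn_pchar ?(eq_pnat _ (pcharf_eq hp)) ?pnat_id // xp expr1n mul1r subrr.
move/eqP; rewrite prodf_seq_eq0 => /hasP[i _]; rewrite addrC subr_eq0 => /eqP <-.
by exists i; rewrite ?ltn_ord.
Qed.

Lemma root_factor_deriv P z :
  P.[z] = 0 -> exists2 P', P = P' * ('X - z%:P) & P'.[z] = P^`().[z].
Proof.
move=> /eqP/factor_theorem[Q ->]; exists Q => //.
by rewrite derivM derivXsubC mulr1 !hornerE subrr mulr0 add0r.
Qed.

(* At a common pole z, the residues of dx / P0 and dx / P1 lie in F_p, so some
   F_p-combination dx / Q has residue 0, although z is a root of Q. *)
Lemma no_common_root n P0 P1 A B C z : log_pencil p n P0 P1 ->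
  P0 != 0 -> P1 != 0 ->
  P0 = C * (B ^+ p - A ^+ p.-1 * B) -> P1 * B = P0 * A -> C.[z] != 0.
Proof.
move=> H P0n0 P1n0 EP0 EP01; apply/eqP => Cz.
have p1 : ~~ (p %| 1)%N by rewrite dvdn1 gtn_eqF.
have [P0' [_ logP0 EP0']] := H 1%N 0%N (introT orP (or_introl p1)).
rewrite mulr1n mulr0n addr0 mulrC in EP0'.
rewrite {P0' EP0'}(mulIf P1n0 EP0') in logP0.
have [P1' [_ logP1 EP1']] := H 0%N 1%N (introT orP (or_intror p1)).
rewrite mulr1n mulr0n add0r in EP1'.
rewrite {P1' EP1'}(mulfI P0n0 EP1') in logP1.
set T0 := B ^+ p - A ^+ p.-1 * B in EP0.
have B0 : B != 0.
  apply: contraNneq P0n0 => B0.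
  by rewrite EP0 /T0 B0 mulr0 subr0 expr0n gtn_eqF // mulr0.
(* [T1] is to P1 what [T0] is to P0: since A T0 = B T1, also P1 = C T1. *)
pose T1 := A * B ^+ p.-1 - A ^+ p.
have AT0 : A * T0 = B * T1.
  by rewrite /T0 /T1 -(prednK p_gt0) !exprS /=; move: (p.-1) => q; ring.
have EP1 : P1 = C * T1.
  by apply: (mulIf B0); rewrite EP01 EP0 -mulrA [T0 * A]mulrC AT0 mulrCA mulrC.
have P0z : P0.[z] = 0 by rewrite EP0 hornerM Cz mul0r.
have P1z : P1.[z] = 0 by rewrite EP1 hornerM Cz mul0r.
have [a0 E0] := dlog_denom_root logP0 P0z.
have [a1 E1] := dlog_denom_root logP1 P1z.
have [p0 Ep0 p0z] := root_factor_deriv P0z.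
have [q1 Ep1 p1z] := root_factor_deriv P1z.
have p0z0 : p0.[z] != 0.
  by rewrite p0z; apply: contraTneq (oner_neq0 k) => z0; rewrite -E0 z0 mul0r eqxx.
have p1z0 : q1.[z] != 0.
  by rewrite p1z; apply: contraTneq (oner_neq0 k) => z0; rewrite -E1 z0 mul0r eqxx.
have a1n0 : a1%:R != 0 :> k.
  by apply: contraTneq (oner_neq0 k) => z0; rewrite -E1 z0 mulr0 eqxx.
have a0n0 : a0%:R != 0 :> k.
  by apply: contraTneq (oner_neq0 k) => z0; rewrite -E0 z0 mulr0 eqxx.
have [c Ec _] := root_factor_deriv Cz.
have Xz : 'X - z%:P != 0 by rewrite polyXsubC_eq0.
have Ep0' : p0 = c * T0 by apply: (mulIf Xz); rewrite -Ep0 EP0 {1}Ec mulrAC.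
have Ep1' : q1 = c * T1 by apply: (mulIf Xz); rewrite -Ep1 EP1 {1}Ec mulrAC.
have T0z : T0.[z] != 0.
  by apply: contraNneq p0z0 => T0z; rewrite Ep0' hornerM T0z mulr0.
have T1z : T1.[z] != 0.
  by apply: contraNneq p1z0 => T1z; rewrite Ep1' hornerM T1z mulr0.
have a1p : ~~ (p %| a1)%N by rewrite (dvdn_pcharf hp).
(* [j] is a natural number representing -a0, so that a1 dx/P0 + j dx/P1 has residue a1 a0 - a0 a1 =
   0 at z. *)
pose j := (p.-1 * a0)%N.
have Ej : j%:R = - a0%:R :> k.
  by rewrite natrM -subn1 natrB // (pcharf0 hp) sub0r mulN1r.
have [Q [_ _ EQ]] := H a1 j (introT orP (or_introl a1p)).
have ENQ : (A *+ a1 + B *+ j) * Q = P1 * B.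
  apply: (mulfI P0n0); rewrite [RHS]mulrA -EQ -[_ *+ a1]mulr_natr -[_ *+ j]mulr_natr.
  rewrite -[P1 *+ a1]mulr_natr -[P0 *+ j]mulr_natr.
  transitivity ((P0 * A * a1%:R + P0 * B * j%:R) * Q); first by ring.
  by rewrite -EP01; ring.
have /eqP := congr1 (horner^~ z) ENQ; rewrite !hornerM P1z mul0r mulf_eq0.
case/orP => [/eqP|/eqP Qz].
  (* If a1 A(z) = a0 B(z), Frobenius gives a1 A(z)^p = a0 B(z)^p, so a0 B(z) T1(z) = 0. Then B(z) =
     0 and T0(z) = 0, a contradiction. *)
  rewrite hornerD !hornerMn -[_ *+ a1]mulr_natr -[_ *+ j]mulr_natr Ej mulrN => /eqP.
  rewrite subr_eq0 => /eqP Nz.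
  have Nzp : A.[z] ^+ p * a1%:R = B.[z] ^+ p * a0%:R.
    by have := congr1 (fun x => x ^+ p) Nz; rewrite !exprMn !natr_expp.
  have BT1 : a0%:R * (B.[z] * T1.[z]) = 0.
    rewrite /T1 hornerD hornerN hornerM !horner_exp.
    transitivity (A.[z] * (B.[z] ^+ p * a0%:R) - (B.[z] * a0%:R) * A.[z] ^+ p).
      by rewrite -[in B.[z] ^+ p](prednK p_gt0) exprS; ring.
    by rewrite -Nz -Nzp; ring.
  move/eqP: BT1; rewrite !mulf_eq0 (negbTE a0n0) (negbTE T1z) orbF /= => /eqP Bz.
  by move: T0z; rewrite /T0 hornerD hornerN hornerM !horner_exp Bz mulr0 subr0
    expr0n gtn_eqF // eqxx.
(* If Q(z) = 0, divide the pencil relation by (X - z)^2. At z its left side has the factor a1 P1'(z)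
   - a0 P0'(z) = 1 - 1 = 0, while the right side is P0'(z) P1'(z), which is nonzero. *)
have [q Eq _] := root_factor_deriv Qz.
have : (q1 *+ a1 + p0 *+ j) * q = p0 * q1.
  apply: (mulIf (mulf_neq0 Xz Xz)).
  transitivity (P0 * P1); last by rewrite Ep0 Ep1; ring.
  by rewrite -EQ Ep0 Ep1 Eq; ring.
move/(congr1 (horner^~ z)); rewrite !hornerM hornerD !hornerMn p0z p1z.
rewrite -[_ *+ a1]mulr_natr -[_ *+ j]mulr_natr Ej mulrN E0 E1 subrr mul0r.
by move/esym/eqP; rewrite mulf_eq0 -p0z -p1z (negbTE p0z0) (negbTE p1z0).
Qed.

Lemma no_log_pencil l P0 P1 : (2 < p)%N -> (0 < l <= 3)%N ->
  ~~ ((l == 2) && (p == 3))%N -> P0 != 0 -> P1 != 0 ->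
  log_pencil p (p * l) P0 P1 -> False.
Proof.
move=> p2 l13 lp P0n0 P1n0 H.
have [A [B [C [[cAB EP0 EP01] C0 sN]]]] := log_pencil_form hp P0n0 P1n0 H.
have p1 : ~~ (p %| 1)%N by rewrite dvdn1 gtn_eqF.
have [A0 _] := sN 1%N 0%N (introT orP (or_introl p1)).
have [B0 sB] := sN 0%N 1%N (introT orP (or_intror p1)).
rewrite !mulr1n !mulr0n ?addr0 ?add0r in A0 B0 sB.
have [c c0 EC] : exists2 c, c != 0 & C = c%:P.
  apply/size_poly1P; apply: contraT => /closed_rootP[z /eqP Cz].
  by have := no_common_root z H P0n0 P1n0 EP0 EP01; rewrite Cz eqxx.
have [P0' [sP0 logP0 EP0']] := H 1%N 0%N (introT orP (or_introl p1)).
rewrite mulr1n mulr0n addr0 mulrC in EP0'; have {}EP0' := mulIf P1n0 EP0'.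
rewrite {}EP0' in sP0 logP0.
(* P0 has degree p l and is [c] times a product of p polynomials, all of the size of [A]. *)
have sA : size A = l.+1.
  have sN0 (i : 'I_p) : B + A *+ i != 0.
    by have [] := sN i 1%N (introT orP (or_intror p1)); rewrite mulr1n addrC.
  move: sP0; rewrite EP0 EC -prod_addMn_poly_pchar // mul_polyC size_scale //.
  rewrite size_prod // (eq_bigr (fun=> size A)) => [|i _].
    have [s ->] : exists s, size A = s.+1.
      by exists (size A).-1; rewrite prednK // size_poly_gt0.
    rewrite sum_nat_const card_ord.
    by rewrite mulnS -addnS addnC addnK => -[/eqP]; rewrite eqn_pmul2l // => /eqP ->.
  by have [] := sN i 1%N (introT orP (or_intror p1)); rewrite mulr1n addrC.
(* This [t] cancels the leading terms of B and t A, which have the same degree. *)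
pose t := lead_coef B / lead_coef A; pose E := B - t *: A.
have lA0 : lead_coef A != 0 by rewrite lead_coef_eq0.
have sE : (size E <= l)%N.
  apply/leq_sizeP => j lj; rewrite coefB coefZ.
  have [->|nlj] := eqVneq j l.
    have -> : B`_l = lead_coef B by rewrite lead_coefE sB sA.
    have -> : A`_l = lead_coef A by rewrite lead_coefE sA.
    by rewrite divfK ?subrr.
  by rewrite !nth_default ?mulr0 ?subr0 // ?sB sA ltn_neqAle eq_sym nlj.
have EB : B = t *: A + E by rewrite addrC subrK.
clearbody E t.
have E0 : E != 0.
  apply: contraTneq cAB => E0; rewrite EB E0 addr0.
  have t0 : t != 0 by apply: contraNneq B0 => t0; rewrite EB E0 t0 scale0r addr0.
  by rewrite coprimepZr // coprimepp sA; case/andP: l13 => l0 _; rewrite eqSS -lt0n.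
(* If t^p = t, then t is the image of some i < p, and B + (p - i) A = E is smaller than A, against
   [sN]. *)
have d0 : t ^+ p - t != 0.
  apply/eqP => /eqP; rewrite subr_eq0 => /eqP/expp_eq_nat[i ip Et].
  have [_] := sN (p - i)%N 1%N (introT orP (or_intror p1)).
  rewrite mulr1n mulrnBr ?(ltnW ip) // mulrn_pchar // sub0r addrC EB Et scaler_nat.
  by rewrite addrAC subrr add0r sA => sE'; rewrite sE' ltnn in sE.
(* With D = A P0 / c one has A D^(p-1) = A^p P0^(p-1) / c^(p-1). The derivative of order p-1 of
   P0^(p-1) is -1, whence u = -1 / c^(p-1). *)
apply: (no_pencil hp (u := - (c ^+ p.-1)^-1) p2 l13 lp sA E0 sE d0).
  by rewrite oppr_eq0 invr_eq0 expf_neq0.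
have -> : ((t ^+ p - t) *: A ^+ p + E ^+ p) * A - A ^+ p * E = A * (B ^+ p - A ^+ p.-1 * B).
  rewrite [in B ^+ p]EB exprDn_pchar ?(eq_pnat _ (pcharf_eq hpP)) ?pnat_id // exprZn.
  rewrite mulrBr [A * (_ ^+ _ * B)]mulrA -exprS prednK // EB -!mul_polyC polyCB; ring.
have -> : A * (A * (B ^+ p - A ^+ p.-1 * B)) ^+ p.-1 =
   A ^+ p * (((c ^+ p.-1)^-1)%:P * P0 ^+ p.-1).
  have cVc : ((c ^+ p.-1)^-1)%:P * c%:P ^+ p.-1 = 1.
    by rewrite -rmorphXn -polyCM mulVf ?expf_neq0.
  by rewrite EP0 EC !exprMn (mulrA _%:P) cVc mul1r mulrA -exprS prednK.
rewrite derivn_mul_const ?deriv_expp // mul_polyC derivnZ derivn_pred_dlog_denom //.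
by rewrite scalerN mulrN alg_polyC mulrC mul_polyC scaleNr.
Qed.

End NoLogPencil.

(** * From forms to polynomials *)

Lemma ord_form_ratio (k : fieldType) (g : ratfun k) : g != 0 ->
  exists n d : {poly k}, [/\ n != 0, d != 0, g * d%:F = n%:F &
    forall P, ord_form P g = if P is Some x then (mup x n)%:Z - (mup x d)%:Z
                             else (size d)%:Z - (size n)%:Z - 2%:Z].
Proof.
move=> g0; exists \n_(repr g), \d_(repr g); have d0 := denom_ratioP (repr g).
split=> //; [|exact: mul_repr_denom | by case].
rewrite -tofrac_eq0 -(mul_repr_denom g); apply: mulf_neq0; first exact: g0.
by rewrite tofrac_eq0.
Qed.

Section Forms.

Variable k : closedFieldType.
Implicit Types (F P Q : {poly k}) (f g : ratfun k).

(** After division by the gcd, a root of the cofactor of n is no root of that of d, against the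
    inequality of multiplicities. So the cofactor of n is constant. *)
Lemma dvdp_mup (n d : {poly k}) : n != 0 -> d != 0 ->
  (forall x, (mup x n <= mup x d)%N) -> n %| d.
Proof.
move=> n0 d0 le_nd; set G := gcdp n d.
have G0 : G != 0 by rewrite gcdp_eq0 negb_and n0.
have En : n = n %/ G * G by rewrite divpK ?dvdp_gcdl.
have Ed : d = d %/ G * G by rewrite divpK ?dvdp_gcdr.
have n'0 : n %/ G != 0 by apply: contraNneq n0 => e; rewrite En e mul0r.
have d'0 : d %/ G != 0 by apply: contraNneq d0 => e; rewrite Ed e mul0r.
have cnd : coprimep (n %/ G) (d %/ G) by rewrite coprimep_div_gcd ?n0.
have /size_poly1P[c c0 Ec] : size (n %/ G) == 1%N.
  apply: contraT => /closed_rootP[x nx].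
  have := le_nd x; rewrite {1}En {1}Ed !mupM // leq_add2r.
  have := coprimep_root cnd nx; rewrite -rootE => /mupNroot ->.
  by rewrite leqn0 -leqn0 leqNgt -XsubC_dvd // dvdp_XsubCl nx.
by rewrite En Ed Ec dvdp_mul2r // -alg_polyC dvdpZl ?dvd1p.
Qed.

(** A linear form whose only zero is [infty], written in the affine coordinate; for the pole of x it
    becomes 1. *)
Definition inf_coord (infty : P1 k) : {poly k} :=
  if infty is Some a then 'X - a%:P else 1.

Lemma inf_coord_neq0 infty : inf_coord infty != 0.
Proof. by case: infty => [a|]; rewrite ?oner_neq0 ?polyXsubC_eq0. Qed.

Lemma mup_inf_coord infty n x :
  mup x (inf_coord infty ^+ n) = if infty == Some x then n else 0%N.
Proof.
rewrite /inf_coord; case: infty => [a|]; first by rewrite mup_XsubCX.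
by rewrite expr1n mupNroot // rootE hornerC oner_neq0.
Qed.

Lemma size_inf_coord infty n :
  size (inf_coord infty ^+ n) = if infty is Some _ then n.+1 else 1%N.
Proof.
rewrite /inf_coord; case: infty => [a|]; last by rewrite expr1n size_poly1.
by rewrite size_exp_neq0 ?polyXsubC_eq0 // size_XsubC mul1n.
Qed.

(* The form g dx is inf_coord^(m-1) dx / P. The last condition says that P, as
   a form of degree m + 1 in two variables, does not vanish at infty. *)
Definition form_denom (infty : P1 k) (m : nat) g P :=
  [/\ P != 0, P%:F * g = (inf_coord infty ^+ m.-1)%:F
    & if infty is Some a then P.[a] != 0 /\ (size P <= m.+2)%N else size P = m.+2].

(** Write g = n/d, not necessarily in lowest terms. The orders at finite points say that n divides d
    Z, with Z the power of [inf_coord], and P is the quotient. The exact order at [infty] and the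
    bound at the pole of x give the condition on the value and the size of P. *)
Lemma only_zero_form_denom infty m g : (0 < m)%N -> g != 0 ->
  only_zero infty m g -> exists P, form_denom infty m g P.
Proof.
move=> m0 g0 [ord_inf ord_le].
have [n [d [n0 d0 En ord_nd]]] := ord_form_ratio g0.
have ord_fin x : (mup x n <= mup x d + (if infty == Some x then m.-1 else 0))%N.
  case: eqP ord_inf ord_le => [->|/eqP nx] ord_inf ord_le.
    by move: ord_inf; rewrite ord_nd; lia.
  by have := ord_le (Some x); rewrite eq_sym => /(_ nx); rewrite ord_nd; lia.
have sz : if infty is Some a then (size d <= (size n).+2)%N else size d = (size n + m.+1)%N.
  case: (infty) ord_inf ord_le => [a|]; rewrite ord_nd.
    by move=> _ /(_ None isT); rewrite ord_nd; lia.
  by move=> + _; lia.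
have mult_inf : if infty is Some a then mup a n = (mup a d + m.-1)%N else True.
  by case: (infty) ord_inf => [a|] //; rewrite ord_nd; lia.
set Z := inf_coord infty ^+ m.-1.
have Z0 : Z != 0 by rewrite expf_neq0 ?inf_coord_neq0.
have mupZ x : mup x Z = if infty == Some x then m.-1 else 0%N.
  exact: mup_inf_coord.
have /dvdpP[P EP] : n %| d * Z.
  by apply: dvdp_mup => // [|x]; rewrite ?mulf_neq0 // mupM // mupZ.
have P0 : P != 0.
  by apply: contraTneq (mulf_neq0 d0 Z0) => P0; rewrite EP P0 mul0r eqxx.
exists P; split=> //.
  apply: (mulIf (_ : d%:F != 0)); first by rewrite tofrac_eq0.
  by rewrite -mulrA En -!tofracM -EP mulrC.
have := congr1 (fun q : {poly k} => size q) EP; rewrite !size_mul //.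
have : forall x, mup x (d * Z) = mup x (P * n) by rewrite EP.
have szZ : size Z = if infty is Some a then m else 1%N.
  by rewrite size_inf_coord prednK.
clearbody Z; rewrite szZ; rewrite -size_poly_gt0 in n0; rewrite -size_poly_gt0 in d0.
case: infty {ord_inf ord_le ord_nd szZ} mupZ sz mult_inf {ord_fin} =>
    [a|] mupZ sz mult_inf Emup Esz.
  rewrite !size_poly_gt0 in n0 d0; split.
    have := Emup a; rewrite !mupM // mupZ eqxx mult_inf => /eqP.
    rewrite -[X in X == _]add0n eqn_add2r => /eqP mP0.
    by apply: contraTN isT => Pa; have := XsubC_dvd a P0; rewrite dvdp_XsubCl rootE Pa -mP0.
  have arith (sd sn sP : nat) : (0 < sn)%N -> (0 < sd)%N -> (sd <= sn.+2)%N ->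
    (sd + m).-1 = (sP + sn).-1 -> (sP <= m.+2)%N by lia.
  by apply: arith sz Esz; rewrite size_poly_gt0.
have arith (sd sn sP : nat) : (0 < sn)%N -> sd = (sn + m.+1)%N ->
  (sd + 1).-1 = (sP + sn).-1 -> sP = m.+2 by lia.
exact: arith sz Esz.
Qed.

(** For f = N/D take F = N D^(p-1) = f D^p: it is a polynomial, and the factor D^p leaves the
    logarithmic derivative unchanged. *)
Lemma logarithmic_form_denom (p : nat) infty m g P :
  p \in [pchar k] -> (0 < m)%N -> logarithmic g ->
  form_denom infty m g P ->
  exists2 F, F != 0 & F * inf_coord infty ^+ m.-1 = P * F^`().
Proof.
move=> hp m0 [f f0 Eg] [P0 EP _].
have p_pr := pcharf_prime hp; have p_gt0 := prime_gt0 p_pr.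
have D0 := denom_ratioP (repr f); have Ef := mul_repr_denom f.
move: Eg; rewrite /ratderiv; move: (\n_ _) (\d_ _) D0 Ef => N D D0 Ef Eg.
have N0 : N != 0.
  by rewrite -tofrac_eq0 -Ef; apply: mulf_neq0; [exact: f0 | rewrite tofrac_eq0].
exists (N * D ^+ p.-1); first by rewrite mulf_neq0 // expf_neq0.
have p2 : p.-1 = p.-2.+1 by rewrite prednK // -ltnS prednK // prime_gt1.
have hp' : (p.-1)%:R = -1 :> {poly k}.
  rewrite -subn1 natrB // (pcharf0 (_ : p \in [pchar {poly k}])) ?pchar_poly //.
  by rewrite sub0r.
have dF : (N * D ^+ p.-1)^`() = D ^+ p.-2 * (N^`() * D - N * D^`()).
  rewrite derivM deriv_exp -mulr_natr hp' p2 /= exprS; ring.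
apply/eqP; rewrite -tofrac_eq dF !tofracM -EP Eg -Ef; apply/eqP.
have cancel (K : fieldType) (x y u v w : K) : x != 0 -> y != 0 ->
    x * y * (y * v) * (w * (u / y ^+ 2 / x)) = w * (v * u).
  by move=> x0 y0; field; rewrite y0 x0.
by rewrite p2 exprS tofracM !tofracXn; apply: cancel; rewrite ?tofrac_eq0.
Qed.

End Forms.

(** * The change of coordinate that moves a finite point to the pole of x *)

Section Inversion.

Variables (k : closedFieldType) (a : k).
Implicit Types (P Q F R : {poly k}).

(* P(a + 1/x) *)
Definition inversion_eval : {poly k} -> ratfun k :=
  horner_eval (a%:P%:F + 'X%:F^-1) \o map_poly (@tofrac _ \o polyC).

HB.instance Definition _ := GRing.RMorphism.on inversion_eval.

Local Notation x := ('X%:F : ratfun k).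

Lemma inversion_evalD : {morph inversion_eval : P Q / P + Q}.
Proof. exact: rmorphD. Qed.

Lemma inversion_evalM : {morph inversion_eval : P Q / P * Q}.
Proof. exact: rmorphM. Qed.

Lemma inversion_evalC c : inversion_eval c%:P = c%:P%:F.
Proof. by rewrite /inversion_eval /= map_polyC /horner_eval hornerC. Qed.

Lemma inversion_eval_XsubC : inversion_eval ('X - a%:P) = x^-1.
Proof.
rewrite /inversion_eval /= rmorphB /= map_polyX map_polyC /horner_eval.
by rewrite hornerXsubC addrC addKr.
Qed.

Lemma fracX_neq0 : x != 0.
Proof. by rewrite tofrac_eq0 polyX_eq0. Qed.

(* R is x^n P(a + 1/x), the reversal of P in degree n at a. *)
Lemma inversion_polyP n P : (size P <= n.+1)%N -> exists R,
  [/\ R%:F = x ^+ n * inversion_eval P,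
      R^`()%:F = n%:R * x ^+ n / x * inversion_eval P
                 - x ^+ n / x ^+ 2 * inversion_eval P^`(),
      (size R <= n.+1)%N, R`_n = P.[a] & P != 0 -> R != 0].
Proof.
elim: n P => [|n IHn] P sP.
  have [c ->] : exists c, P = c%:P by exists P`_0; apply: size1_polyC.
  exists c%:P; rewrite inversion_evalC derivC !rmorph0 mulr0 subr0 !mul0r mul1r.
  by split; rewrite // ?size_polyC_leq1 ?coefC ?hornerC.
(* From P = P(a) + Q (X - a), the reversal of P in degree n+1 is P(a) X^(n+1) plus the reversal of Q
   in degree n. *)
have /factor_theorem[Q EQ] : root (P - P.[a]%:P) a.
  by rewrite rootE !hornerE subrr.
have EP : P = P.[a]%:P + Q * ('X - a%:P) by rewrite -EQ addrC subrK.
have sQ : (size Q <= n.+1)%N.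
  have [->|Q0] := eqVneq Q 0; first by rewrite size_poly0.
  have : (size (Q * ('X - a%:P))%R <= n.+2)%N.
    rewrite -EQ (leq_trans (size_polyD _ _)) // geq_max sP size_polyN.
    by rewrite (leq_trans (size_polyC_leq1 _)).
  by rewrite size_mul ?polyXsubC_eq0 // size_XsubC addn2.
have [R [ER EdR sR cR R0]] := IHn Q sQ.
set c := P.[a] in EP *.
have evP : inversion_eval P = c%:P%:F + inversion_eval Q / x.
  by rewrite {1}EP inversion_evalD inversion_evalM inversion_evalC inversion_eval_XsubC.
have evdP : inversion_eval P^`() = inversion_eval Q + inversion_eval Q^`() / x.
  rewrite {1}EP derivD derivC derivM derivXsubC add0r mulr1 addrC inversion_evalD inversion_evalM.
  by rewrite inversion_eval_XsubC.
have x0 := fracX_neq0.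
exists (c *: 'X^(n.+1) + R); split.
- have eq1 (K : fieldType) (d y yn v : K) : y != 0 ->
      d * (y * yn) + yn * v = y * yn * (d + v / y) by move=> y0; field.
  rewrite evP -mul_polyC tofracD tofracM tofracXn ER exprS; exact: eq1.
- have eq2 (K : fieldType) (d y yn N v v' : K) : y != 0 ->
      d * (yn * (N + 1)) + (N * yn / y * v - yn / y ^+ 2 * v') =
      (N + 1) * (y * yn) / y * (d + v / y) - y * yn / y ^+ 2 * (v + v' / y).
    by move=> y0; field.
  rewrite evP evdP derivD derivZ derivXn /= -mul_polyC -mulr_natr.
  rewrite tofracD EdR !tofracM tofracXn rmorph_nat -(natr1 n) (exprS _ n).
  exact: eq2.
- rewrite (leq_trans (size_polyD _ _)) // geq_max (leq_trans (size_scale_leq _ _)) ?size_polyXn //.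
  exact: leqW.
- by rewrite coefD coefZ coefXn eqxx mulr1 [R`_n.+1]nth_default ?addr0.
- move=> P0; apply: contraNneq P0 => R0'.
  have c0 : c = 0.
    have := congr1 (fun q : {poly k} => q`_n.+1) R0'.
    by rewrite coefD coefZ coefXn eqxx mulr1 [R`_n.+1]nth_default ?addr0 // coef0.
  rewrite c0 scale0r add0r in R0'.
  have [Q0|/R0] := eqVneq Q 0; last by rewrite R0' eqxx.
  by rewrite EP c0 Q0 mul0r addr0.
Qed.

End Inversion.

(** * From a space of forms to a pencil of polynomials *)

Section Transport.

Variables (k : closedFieldType) (p : nat).
Hypothesis hp : p \in [pchar k].

Let p_pr : prime p := pcharf_prime hp.
Let p_gt0 : (0 < p)%N := prime_gt0 p_pr.
Implicit Types (F P Q : {poly k}) (f g : ratfun k).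

Lemma form_denom_relation infty m g0 g1 P0 P1 P (i j : nat) :
  form_denom infty m g0 P0 -> form_denom infty m g1 P1 ->
  form_denom infty m (g0 *+ i + g1 *+ j) P ->
  (P1 *+ i + P0 *+ j) * P = P0 * P1.
Proof.
move=> [_ E0 _] [_ E1 _] [_ E _]; set z := (_ ^+ _)%:F in E0 E1 E.
have z0 : z != 0 by rewrite tofrac_eq0 expf_neq0 ?inf_coord_neq0.
apply/eqP; rewrite -tofrac_eq; apply/eqP/(mulfI z0).
rewrite !tofracM tofracD !tofracMn -{2}E.
move: P0%:F P1%:F P%:F E0 E1 => a b c E0 E1.
transitivity ((b *+ i) * c * (a * g0) + (a *+ j) * c * (b * g1)); last by ring.
by rewrite E0 E1; ring.
Qed.

(* The substitution x -> a + 1/x is applied to F, multiplied by the p-th power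
   x^(p size F) to make it a polynomial; the sign comes from d(1/x) = - dx / x^2. *)
Lemma dlog_denom_inversion a m P F R : (0 < m)%N -> F != 0 ->
  F * inf_coord (Some a) ^+ m.-1 = P * F^`() ->
  R%:F = 'X%:F ^+ m.+1 * inversion_eval a P -> dlog_denom (- R).
Proof.
move=> m0 F0 EF ER.
have [S [ES EdS _ _ S0]] := @inversion_polyP k a (p * size F) F
  (leq_trans (leq_pmull _ p_gt0) (leqnSn _)).
exists S; first exact: S0.
(* The reversal degree is a multiple of p, which kills the first term of the derivative of [S]. *)
have px0 : (p * size F)%:R = 0 :> ratfun k.
  rewrite natrM (pcharf0 (_ : p \in [pchar ratfun k])) ?mul0r //.
  by rewrite (rmorph_pchar (@tofrac {poly k})) ?pchar_poly.
rewrite px0 !mul0r sub0r in EdS.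
have := congr1 (inversion_eval a) EF; rewrite !inversion_evalM rmorphXn /=.
rewrite inversion_eval_XsubC => E; apply/eqP; rewrite -tofrac_eq; apply/eqP.
rewrite tofracM tofracN ER EdS ES mulrNN.
have cancel (K : fieldType) (x y u q d : K) : x != 0 ->
    u * x^-1 ^+ m.-1 = q * d -> y * u = x ^+ m.+1 * q * (y / x ^+ 2 * d).
  move=> x0 Eqd; transitivity (x ^+ m.+1 * (y / x ^+ 2) * (q * d)); last by ring.
  rewrite -Eqd exprVn (_ : m.+1 = m.-1 + 2)%N ?exprD; last by rewrite addn2 prednK.
  by have := expf_neq0 m.-1 x0; move: (x ^+ m.-1) => z z0; field; rewrite x0 z0.
by apply: cancel E; exact: fracX_neq0.
Qed.

(** If [infty] is the pole of x, the denominators of the forms serve as they are. Otherwise x -> a +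
    1/x moves [infty] there, and the denominators, of degree at most m+1, are reversed in degree
    m+1. *)
Lemma is_L_log_pencil (infty : P1 k) m (V : ratfun k -> Prop) : (0 < m)%N -> is_L p infty m 2 V ->
  exists P0 P1 : {poly k}, [/\ P0 != 0, P1 != 0 & log_pencil p m.+1 P0 P1].
Proof.
move=> m0 [[w [free_w spanV] logV zeroV]].
pose g (i j : nat) := w ord0 *+ i + w (lift ord0 ord0) *+ j.
have hpK : p \in [pchar ratfun k].
  by rewrite (rmorph_pchar (@tofrac {poly k})) ?pchar_poly.
have comb i j : g i j = Fp_comb w (fun t : 'I_2 => if t == ord0 then i%:R else j%:R : 'F_p).
  have modp (f : ratfun k) n : f *+ (n%:R : 'F_p) = f *+ n.
    by rewrite val_Fp_nat // [in RHS](divn_eq n p) mulrnDr mulrnA (mulrn_pchar hpK) add0r.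
  by rewrite /Fp_comb big_ord_recl big_ord1 /= !modp.
have gV i j : V (g i j) by apply/spanV; eexists; apply: comb.
have g0 i j : ~~ (p %| i)%N || ~~ (p %| j)%N -> g i j != 0.
  apply: contraTneq; rewrite comb => /free_w c0.
  have := c0 ord0; have := c0 (lift ord0 ord0); rewrite /= => /eqP + /eqP.
  by rewrite -!(dvdn_pcharf (pchar_Fp p_pr)) => -> ->.
have denomP i j : ~~ (p %| i)%N || ~~ (p %| j)%N -> exists P, form_denom infty m (g i j) P.
  by move=> /g0 gn0; exact: (only_zero_form_denom m0 gn0 (zeroV _ (gV i j) gn0)).
have p1 : ~~ (p %| 1)%N by rewrite dvdn1 gtn_eqF // prime_gt1.
have [P0 D0] := denomP 1%N 0%N (introT orP (or_introl p1)).
have [P1 D1] := denomP 0%N 1%N (introT orP (or_intror p1)).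
have pencil i j : ~~ (p %| i)%N || ~~ (p %| j)%N -> exists P,
    [/\ form_denom infty m (g i j) P, (P1 *+ i + P0 *+ j) * P = P0 * P1
      & exists2 F, F != 0 & F * inf_coord infty ^+ m.-1 = P * F^`()].
  move=> pij; have [P D] := denomP i j pij; exists P; split=> //.
    apply: (form_denom_relation D0 D1); move: D.
    by rewrite /g !mulr1n !mulr0n addr0 add0r.
  exact: (logarithmic_form_denom hp m0 (logV _ (gV i j)) D).
have {D0 D1 denomP} [D0 D1] :
    form_denom infty m (w ord0) P0 /\ form_denom infty m (w (lift ord0 ord0)) P1.
  by move: D0 D1; rewrite /g !mulr1n !mulr0n addr0 add0r.
case: infty {zeroV} D0 D1 pencil => [a|] [P00 _ D0] [P10 _ D1] pencil; last first.
  exists P0, P1; split=> // i j /pencil[P [[_ _ sP] rel [F F0 EF]]].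
  exists P; split=> //; exists F => //.
  by rewrite -EF expr1n mulr1.
have [[_ sP0] [_ sP1]] := (D0, D1).
have [R0 [ER0 _ _ _ R0n0]] := inversion_polyP a sP0.
have [R1 [ER1 _ _ _ R1n0]] := inversion_polyP a sP1.
exists (- R0), (- R1); rewrite !oppr_eq0; split; [exact: R0n0 | exact: R1n0 |].
move=> i j /pencil[P [[Pn0 _ [Pa sP]] rel [F F0 EF]]].
have [R [ER _ sR Rm _]] := inversion_polyP a sP.
exists (- R); split; last 1 first.
- rewrite !mulNrn -opprD !mulrNN; apply/eqP; rewrite -tofrac_eq; apply/eqP.
  rewrite !tofracM tofracD !tofracMn ER ER0 ER1.
  have := congr1 (inversion_eval a) rel.
  rewrite !inversion_evalM inversion_evalD !rmorphMn => E.
  by rewrite mulrACA -E; ring.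
(* The coefficient of degree m+1 is P(a), which is nonzero, so the degree is exactly m+1. *)
- rewrite size_polyN; apply/eqP; rewrite eqn_leq sR /= ltnNge; apply/negP => /leq_sizeP.
  by move=> /(_ _ (leqnn _))/eqP; rewrite Rm (negbTE Pa).
- exact: (dlog_denom_inversion m0 F0 EF ER).
Qed.

End Transport.

(** * Existence in characteristic three *)

Section LogDeriv.

Variable k : fieldType.
Implicit Types (F P Q N D : {poly k}) (f g : ratfun k).

Definition dlogp F : ratfun k := F^`()%:F / F%:F.

Lemma dlogpM F Q : F != 0 -> Q != 0 -> dlogp (F * Q) = dlogp F + dlogp Q.
Proof.
move=> F0 Q0; rewrite /dlogp derivM tofracD !tofracM.
have eqf (K : fieldType) (a b c d : K) : a != 0 -> b != 0 ->
  (c * b + a * d) / (a * b) = c / a + d / b by move=> a0 b0; field; rewrite b0 a0.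
by apply: eqf; rewrite tofrac_eq0.
Qed.

Lemma dlogpX F n : F != 0 -> dlogp (F ^+ n) = dlogp F *+ n.
Proof.
move=> F0; elim: n => [|n IHn]; first by rewrite /dlogp derivC rmorph0 mul0r.
by rewrite exprS dlogpM ?expf_neq0 // IHn mulrS.
Qed.

Lemma logarithmic_dlogp F : F != 0 -> logarithmic (dlogp F).
Proof.
move=> F0; exists F%:F; first by rewrite tofrac_eq0.
have := @ratderiv_frac k F 1 (oner_neq0 _).
by rewrite derivC mulr1 mulr0 subr0 expr1n tofrac1 !divr1 => ->.
Qed.

End LogDeriv.

(** A converse to [only_zero_form_denom]: the orders are read off the quotient of the power of
    [inf_coord] by P. *)
Lemma form_denom_only_zero (k : closedFieldType) (infty : P1 k) m (g : ratfun k) P : (0 < m)%N ->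
  form_denom infty m g P -> only_zero infty m g.
Proof.
move=> m0 [P0 Pg sP]; set Z := inf_coord infty ^+ m.-1 in Pg.
have Z0 : Z != 0 by rewrite expf_neq0 ?inf_coord_neq0.
have P0' : P%:F != 0 by rewrite tofrac_eq0.
have Eg : g = Z%:F / P%:F by rewrite -Pg mulrAC divff // mul1r.
have ord_g Q : ord_form Q g = if Q is Some x then (mup x Z)%:Z - (mup x P)%:Z
                              else (size P)%:Z - (size Z)%:Z - 2%:Z.
  by case: Q => [x|]; rewrite /ord_form Eg ord_fun_frac.
have mupZ x : mup x Z = if infty == Some x then m.-1 else 0%N by exact: mup_inf_coord.
have szZ : size Z = if infty is Some a then m else 1%N by rewrite size_inf_coord prednK.
rewrite /only_zero ord_g; clearbody Z; case: infty {Pg} sP mupZ szZ => [a|] sP mupZ szZ.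
  have [Pa sP'] := sP; rewrite mupZ eqxx (mupNroot (Pa : ~~ root P a)).
  split; first by lia.
  case=> [x|]; rewrite ord_g ?mupZ => nx; last by rewrite szZ; lia.
  by rewrite eq_sym (negbTE nx); lia.
split; first by rewrite sP szZ; lia.
by case=> [x|] // _; rewrite ord_g mupZ /=; lia.
Qed.

Section CharThree.

Variable k : closedFieldType.
Hypothesis hp3 : 3%N \in [pchar k].
Variable infty : P1 k.

(* Y / Z is a coordinate with its pole at infty. *)
Let Y : {poly k} := if infty is Some _ then 1 else 'X.
Let Z : {poly k} := inf_coord infty.
(** The Wronskian of the coordinate: d(Y/Z) = s dx / Z^2. *)
Let s : {poly k} := Y^`() * Z - Y * Z^`().

Let h3 : 3%:R = 0 :> k := pcharf0 hp3.

Lemma wronskian_sqr : s ^+ 2 = 1.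
Proof.
rewrite /s /Y /Z /inf_coord; case: infty => [a|].
  by rewrite derivC derivXsubC mul0r mul1r sub0r expr2 mulrNN mulr1.
by rewrite derivX derivC mulr1 mulr0 subr0 expr1n.
Qed.

(** The polynomial al A + be with A = y^2 - 1, homogenised by y = Y/Z. With B = t A + 1, the element
    B + i A is [line (t + i) 1]. *)
Definition line (al be : k) : {poly k} := al%:P * (Y ^+ 2 - Z ^+ 2) + be%:P * Z ^+ 2.

(* P comes from a form of degree n in Y and Z which does not vanish at infty. *)
Definition pole_cond n (P : {poly k}) :=
  if infty is Some a then P.[a] != 0 /\ (size P <= n.+1)%N else size P = n.+1.

Lemma pole_cond_neq0 n P : pole_cond n P -> P != 0.
Proof.
rewrite /pole_cond; case: infty => [a [Pa _]|sP].
  by apply: contraNneq Pa => ->; rewrite horner0.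
by rewrite -size_poly_gt0 sP.
Qed.

Lemma pole_condM n1 n2 P1 P2 : pole_cond n1 P1 -> pole_cond n2 P2 ->
  pole_cond (n1 + n2) (P1 * P2).
Proof.
move=> c1 c2; have := pole_cond_neq0 c1; have := pole_cond_neq0 c2.
move: c1 c2; rewrite /pole_cond; case: infty => [a [P1a s1] [P2a s2]|s1 s2] P20 P10.
  rewrite hornerM mulf_neq0 //; split=> //.
  rewrite size_mul //; move: (size P1) (size P2) s1 s2; lia.
by rewrite size_mul // s1 s2 addnS.
Qed.

Lemma pole_cond_line al be : al != 0 -> pole_cond 2 (line al be).
Proof.
move=> al0; rewrite /pole_cond /line /Y /Z /inf_coord; case: infty => [a|].
  split.
    by rewrite !hornerE subrr expr0n /= !mulr0 addr0 subr0 expr1n mulr1.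
  rewrite (_ : _ + _ = al%:P + (be - al)%:P * ('X - a%:P) ^+ 2); last first.
    by rewrite polyCB expr1n; ring.
  rewrite (leq_trans (size_polyD _ _)) // geq_max (leq_trans (size_polyC_leq1 _)) //=.
  by rewrite mul_polyC (leq_trans (size_scale_leq _ _)) // size_exp_XsubC.
rewrite (_ : _ + _ = al *: 'X^2 + (be - al)%:P); last first.
  by rewrite polyCB !expr1n -mul_polyC; ring.
rewrite size_polyDl size_scale ?size_polyXn //.
by rewrite (leq_ltn_trans (size_polyC_leq1 _)).
Qed.

Lemma pole_cond_wronskian : pole_cond 0 s.
Proof.
rewrite /pole_cond /s /Y /Z /inf_coord; case: infty => [a|].
  rewrite derivC derivXsubC mul0r mul1r sub0r hornerN hornerC size_polyN size_poly1.
  by rewrite oppr_eq0 oner_neq0.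
by rewrite derivX derivC mulr1 mulr0 subr0 size_poly1.
Qed.

(* In characteristic 3 it has the logarithmic derivative of
   (Y - v Z) / (Y + v Z). *)
Definition quad (v : k) : {poly k} := (Y - v%:P * Z) * (Y + v%:P * Z) ^+ 2.

Lemma coord_line_neq0 v : Y + v%:P * Z != 0.
Proof.
rewrite /Y /Z /inf_coord; case: infty => [a|].
  apply/eqP => /(congr1 (horner^~ a)) /eqP.
  by rewrite !hornerE subrr mulr0 addr0 oner_eq0.
by rewrite mulr1 -[v%:P]opprK -polyCN polyXsubC_eq0.
Qed.

Lemma quad_neq0 v : quad v != 0.
Proof.
by rewrite mulf_neq0 ?expf_neq0 ?coord_line_neq0 // -mulNr -polyCN coord_line_neq0.
Qed.

Lemma two_char3 (R : nzRingType) : 3%:R = 0 :> R -> 2%:R = -1 :> R.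
Proof. by move=> h; apply/eqP; rewrite -subr_eq0 opprK natr1 h. Qed.

Let h3P : 3%:R = 0 :> {poly k}.
Proof. by rewrite -(rmorph_nat polyC) h3 rmorph0. Qed.

Let h3K : 3%:R = 0 :> ratfun k.
Proof. by rewrite -(rmorph_nat (@tofrac {poly k})) h3P rmorph0. Qed.

(** The equality 2 = -1 is used twice: for the exponent 2 in [quad], and to turn the numerator 2 v s
    into -v s. *)
Lemma dlogp_quad v :
  dlogp (quad v) = - (v%:P * s)%:F / (Y ^+ 2 - v%:P ^+ 2 * Z ^+ 2)%:F.
Proof.
have p0 := coord_line_neq0 v; have m0 : Y - v%:P * Z != 0.
  by rewrite -mulNr -polyCN coord_line_neq0.
rewrite /quad dlogpM ?expf_neq0 // dlogpX // -mulr_natr two_char3 // mulrN1.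
rewrite (_ : Y ^+ 2 - v%:P ^+ 2 * Z ^+ 2 = (Y - v%:P * Z) * (Y + v%:P * Z)); last by ring.
rewrite /dlogp derivB derivD derivM derivC mul0r add0r.
have -> : - (v%:P * s)%:F = ((Y^`() - v%:P * Z^`()) * (Y + v%:P * Z)
      - (Y^`() + v%:P * Z^`()) * (Y - v%:P * Z))%:F.
  rewrite -tofracN; congr (_%:F).
  transitivity (2%:R * (v%:P * s)); last by rewrite /s; ring.
  by rewrite (two_char3 h3P) mulN1r.
have eqK (K : fieldType) (a b c d : K) : a != 0 -> b != 0 ->
  c / a - d / b = (c * b - d * a) / (a * b) by move=> a0 b0; field; rewrite b0 a0.
have eqF (n1 n2 d1 d2 : {poly k}) : d1 != 0 -> d2 != 0 ->
    n1%:F / d1%:F - n2%:F / d2%:F = (n1 * d2 - n2 * d1)%:F / (d1 * d2)%:F.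
  by move=> d10 d20; rewrite tofracB !tofracM; apply: eqK; rewrite tofrac_eq0.
exact: eqF.
Qed.

(** The cubic equation makes [line v 1] equal to v Y^2 - v^3 Z^2, which splits into the two factors
    of [quad v] up to the constant v. *)
Lemma dlogp_quad_line v : v ^+ 3 = v - 1 -> v != 0 ->
  dlogp (quad v) = - s%:F * (v%:P%:F ^+ 2 / (line v 1)%:F).
Proof.
move=> v3 v0; rewrite dlogp_quad.
have -> : line v 1 = v%:P * (Y ^+ 2 - v%:P ^+ 2 * Z ^+ 2).
  transitivity (v%:P * Y ^+ 2 - v%:P ^+ 3 * Z ^+ 2); last by ring.
  by rewrite -rmorphXn /= v3 polyCB /line polyC1; ring.
have vF : v%:P%:F != 0 by rewrite tofrac_eq0 polyC_eq0.
have eqK (K : fieldType) (c d e : K) : c != 0 -> - (c * d) / e = - d * (c ^+ 2 / (c * e)).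
  have [->|e0] := eqVneq e 0; first by rewrite mulr0 invr0 !mulr0.
  by move=> c0; field; rewrite c0 e0.
by rewrite !tofracM; exact: eqK.
Qed.

(** The partial fractions of [w0] below. Without the assumption on 3, the two sides differ by the
    explicit multiple of 3. As b - t a will be Z^2, the numerator becomes Z^4, as a zero of order 4
    at [infty] requires. *)
Lemma char3_sum1 (K : fieldType) (t a b : K) : 3%:R = 0 :> K ->
  b != 0 -> b - a != 0 -> b + a != 0 ->
  t ^+ 2 / b + (t - 1) ^+ 2 / (b - a) + (t + 1) ^+ 2 / (b + a) =
  - ((b - t * a) ^+ 2 / (b * (b - a) * (b + a))).
Proof.
move=> h b0 m0 p0; transitivity (- ((b - t * a) ^+ 2 / (b * (b - a) * (b + a))) +
  3%:R * ((b ^+ 2 * t ^+ 2 + b ^+ 2 - 2%:R * t * a * b) / (b * (b - a) * (b + a)))).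
  by field; rewrite b0 m0 p0.
by rewrite h mul0r addr0.
Qed.

(** The same for [w1]; the term 1/a comes from [quad 1], and the multiples by 2 act as signs. *)
Lemma char3_sum2 (K : fieldType) (t a b : K) : 3%:R = 0 :> K ->
  a != 0 -> b - a != 0 -> b + a != 0 ->
  (t - 1) ^+ 2 / (b - a) + (t + 1) ^+ 2 / (b + a) *+ 2 + 1 / a *+ 2 =
  - ((b - t * a) ^+ 2 / (a * (b - a) * (b + a))).
Proof.
move=> h a0 m0 p0; transitivity (- ((b - t * a) ^+ 2 / (a * (b - a) * (b + a))) +
  3%:R * ((a * b * (t ^+ 2 + 1) - a ^+ 2 * (2%:R * t + 1) + b ^+ 2) /
          (a * (b - a) * (b + a)))).
  by field; rewrite a0 m0 p0.
by rewrite h mul0r addr0.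
Qed.

Lemma form_denomN m (g : ratfun k) P :
  form_denom infty m g P -> form_denom infty m (- g) (- P).
Proof.
case=> P0 E c; split; first by rewrite oppr_eq0.
  by rewrite tofracN mulrNN.
by move: c; case: infty => [a|]; rewrite size_polyN // hornerN oppr_eq0.
Qed.

(** Up to sign, the nonzero combinations are [w0], [w1], [w0 + w1] and [w1 - w0]. Each is s Z^4
    divided, up to sign, by a product of three of A, B, B - A, B + A, which has degree 6 = m+1 in Y
    and Z. *)
Lemma exists_L_char3 : exists V : ratfun k -> Prop, is_L 3 infty 5 2 V.
Proof.
have [t Et] : exists t : k, t ^+ 3 = t - 1.
  have sz : size ('X^3 - 'X + 1 : {poly k}) = 4%N.
    rewrite -addrA size_polyDl size_polyXn //.
    by rewrite (leq_ltn_trans (size_polyD _ _)) // size_polyN size_polyX size_poly1.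
  have /closed_rootP[t] : size ('X^3 - 'X + 1 : {poly k}) != 1%N by rewrite sz.
  rewrite rootE !hornerE => /eqP Et; exists t.
  by apply/eqP; rewrite -subr_eq0 opprB addrA addrAC Et.
have cube_neq0 (v : k) : v ^+ 3 = v - 1 -> v != 0.
  move=> Ev; apply: contraTneq (oner_neq0 k) => v0.
  by move: Ev; rewrite v0 expr0n sub0r => /eqP; rewrite eq_sym oppr_eq0 => ->.
(* In characteristic 3 the solutions of v^3 = v - 1 are stable under adding 1 or -1, so
   [dlogp_quad_line] applies to t, t - 1 and t + 1. *)
have Em : (t - 1) ^+ 3 = t - 1 - 1.
  transitivity (t ^+ 3 - 1 + 3%:R * (t - t ^+ 2)); first by ring.
  by rewrite h3 mul0r addr0 Et.
have Ep : (t + 1) ^+ 3 = t + 1 - 1.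
  transitivity (t ^+ 3 + 1 + 3%:R * (t ^+ 2 + t)); first by ring.
  by rewrite h3 mul0r addr0 Et; ring.
have [t0 tm0 tp0] := And3 (cube_neq0 _ Et) (cube_neq0 _ Em) (cube_neq0 _ Ep).
pose A := line 1 0; pose B := line t 1.
have EBm : line (t - 1) 1 = B - A by rewrite /A /B /line polyCB polyC0 polyC1; ring.
have EBp : line (t + 1) 1 = B + A by rewrite /A /B /line polyCD polyC0 polyC1; ring.
have EBt : B - t%:P * A = Z ^+ 2 by rewrite /A /B /line polyC0 polyC1; ring.
have cA : pole_cond 2 A by apply: pole_cond_line; apply: oner_neq0.
have cB : pole_cond 2 B by apply: pole_cond_line.
have cBm : pole_cond 2 (B - A) by rewrite -EBm; apply: pole_cond_line.
have cBp : pole_cond 2 (B + A) by rewrite -EBp; apply: pole_cond_line.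
have qA : dlogp (quad 1) = - s%:F * (1 / A%:F).
  by rewrite dlogp_quad /A /line polyC1 polyC0 !mul1r mul0r addr0 expr1n mul1r.
pose a := A%:F; pose b := B%:F; pose T := t%:P%:F : ratfun k.
have a0 : a != 0 by rewrite tofrac_eq0 (pole_cond_neq0 cA).
have b0 : b != 0 by rewrite tofrac_eq0 (pole_cond_neq0 cB).
have m0 : b - a != 0 by rewrite -tofracB tofrac_eq0 (pole_cond_neq0 cBm).
have p0 : b + a != 0 by rewrite -tofracD tofrac_eq0 (pole_cond_neq0 cBp).
have EZ : (b - T * a) ^+ 2 = (Z ^+ 4)%:F.
  by rewrite -tofracM -tofracB EBt -tofracXn -exprM.
have dlog3 (F1 F2 F3 : {poly k}) : F1 != 0 -> F2 != 0 -> F3 != 0 ->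
    dlogp (F1 * F2 * F3) = dlogp F1 + dlogp F2 + dlogp F3.
  by move=> *; rewrite !dlogpM ?mulf_neq0.
have dlog3X (F1 F2 F3 : {poly k}) : F1 != 0 -> F2 != 0 -> F3 != 0 ->
    dlogp (F1 * (F2 ^+ 2 * F3 ^+ 2)) = dlogp F1 + (dlogp F2 *+ 2 + dlogp F3 *+ 2).
  by move=> *; rewrite (dlogpM (F := F1)) ?mulf_neq0 ?expf_neq0 //
    (dlogpM (F := F2 ^+ 2)) ?expf_neq0 // !dlogpX.
have Fm : (line (t - 1) 1)%:F = b - a by rewrite EBm tofracB.
have Fp : (line (t + 1) 1)%:F = b + a by rewrite EBp tofracD.
have sum_out (K : fieldType) (x u1 u2 u3 r : K) :
    u1 + u2 + u3 = - r -> - x * u1 + - x * u2 + - x * u3 = x * r.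
  by move=> E; rewrite -!mulrDr E mulrNN.
have sum_out2 (K : fieldType) (x u1 u2 u3 r : K) :
    u1 + u2 *+ 2 + u3 *+ 2 = - r -> - x * u1 + ((- x * u2) *+ 2 + (- x * u3) *+ 2) = x * r.
  by move=> E; rewrite -!mulrnAr -!mulrDr addrA E mulrNN.
pose w0 := dlogp (quad t * quad (t - 1) * quad (t + 1)).
pose w1 := dlogp (quad (t - 1) * (quad (t + 1) ^+ 2 * quad 1 ^+ 2)).
have Tm : (t - 1)%:P%:F = T - 1 by rewrite polyCB tofracB polyC1 tofrac1.
have Tp : (t + 1)%:P%:F = T + 1 by rewrite polyCD tofracD polyC1 tofrac1.
have Ew0 : w0 = s%:F * ((Z ^+ 4)%:F / (b * (b - a) * (b + a))).
  rewrite /w0 dlog3 ?quad_neq0 // !dlogp_quad_line // Fm Fp Tm Tp.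
  apply: sum_out; rewrite -EZ; exact: (char3_sum1 T h3K b0 m0 p0).
have Ew1 : w1 = s%:F * ((Z ^+ 4)%:F / (a * (b - a) * (b + a))).
  rewrite /w1 dlog3X ?quad_neq0 //.
  rewrite qA !dlogp_quad_line // Fm Fp Tm Tp.
  apply: sum_out2; rewrite -EZ; exact: (char3_sum2 T h3K a0 m0 p0).
(* As s is its own inverse, the factor s of the forms can be moved into their denominators. *)
have ss : s%:F * s%:F = 1 by rewrite -tofracM -expr2 wronskian_sqr.
have [F0 F00 EF0] : exists2 F, F != 0 & w0 = dlogp F.
  exists (quad t * quad (t - 1) * quad (t + 1)) => //.
  exact: mulf_neq0 (mulf_neq0 (quad_neq0 _) (quad_neq0 _)) (quad_neq0 _).
have [F1 F10 EF1] : exists2 F, F != 0 & w1 = dlogp F.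
  exists (quad (t - 1) * (quad (t + 1) ^+ 2 * quad 1 ^+ 2)) => //.
  by apply: mulf_neq0 (quad_neq0 _) (mulf_neq0 (expf_neq0 _ _) (expf_neq0 _ _)); apply: quad_neq0.
clearbody w0 w1.
have cs := pole_cond_wronskian.
have base P g : pole_cond 6 P -> P%:F * g = s%:F * s%:F * (Z ^+ 4)%:F ->
    form_denom infty 5 g P.
  by move=> cP Eg; split; [exact: pole_cond_neq0 cP | rewrite Eg ss mul1r | exact: cP].
clearbody A B s.
have tofracM4 (P1 P2 P3 P4 : {poly k}) :
    (P1 * (P2 * P3 * P4))%:F = P1%:F * (P2%:F * P3%:F * P4%:F).
  by rewrite !tofracM.
have fm : (B - A)%:F = b - a by exact: tofracB.
have fp : (B + A)%:F = b + a by exact: tofracD.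
have cancel1 (K : fieldType) (c x z : K) : c != 0 -> x * c * (x * (z / c)) = x * x * z.
  by move=> c0; field.
have cancelD (K : fieldType) (x z c d : K) : c != 0 -> d != 0 -> d - c != 0 -> d + c != 0 ->
    x * (c * d * (d - c)) * (x * (z / (d * (d - c) * (d + c))) +
      x * (z / (c * (d - c) * (d + c)))) = x * x * z.
  by move=> c0 d0 cd dc; field; rewrite c0 d0 cd dc.
have cancelB (K : fieldType) (x z c d : K) : c != 0 -> d != 0 -> d - c != 0 -> d + c != 0 ->
    x * (c * d * (d + c)) * (x * (z / (c * (d - c) * (d + c))) -
      x * (z / (d * (d - c) * (d + c)))) = x * x * z.
  by move=> c0 d0 cd dc; field; rewrite c0 d0 cd dc.
have D10 : exists P, form_denom infty 5 w0 P.
  exists (s * (B * (B - A) * (B + A))); apply: base.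
    exact: (pole_condM cs (pole_condM (pole_condM cB cBm) cBp)).
  rewrite Ew0 tofracM4 fm fp; exact: cancel1 (mulf_neq0 (mulf_neq0 b0 m0) p0).
have D01 : exists P, form_denom infty 5 w1 P.
  exists (s * (A * (B - A) * (B + A))); apply: base.
    exact: (pole_condM cs (pole_condM (pole_condM cA cBm) cBp)).
  rewrite Ew1 tofracM4 fm fp; exact: cancel1 (mulf_neq0 (mulf_neq0 a0 m0) p0).
have D11 : exists P, form_denom infty 5 (w0 + w1) P.
  exists (s * (A * B * (B - A))); apply: base.
    exact: (pole_condM cs (pole_condM (pole_condM cA cB) cBm)).
  rewrite Ew0 Ew1 tofracM4 fm; exact: cancelD a0 b0 m0 p0.
have D21 : exists P, form_denom infty 5 (w1 - w0) P.
  exists (s * (A * B * (B + A))); apply: base.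
    exact: (pole_condM cs (pole_condM (pole_condM cA cB) cBp)).
  rewrite Ew0 Ew1 tofracM4 fp; exact: cancelB a0 b0 m0 p0.
have DN g : (exists P, form_denom infty 5 g P) -> exists P, form_denom infty 5 (- g) P.
  by case=> P D; exists (- P); exact: form_denomN.
pose w (i : 'I_2) := if i == ord0 then w0 else w1.
have comb (c : 'I_2 -> 'F_3) : Fp_comb w c = w0 *+ c ord0 + w1 *+ c (lift ord0 ord0).
  by rewrite /Fp_comb big_ord_recl big_ord1.
have mul2 (g : ratfun k) : g *+ 2 = - g by rewrite -mulr_natr (two_char3 h3K) mulrN1.
(* Since 2 = -1, the eight pairs reduce by sign to the four forms already treated. *)
have denom i j : (i < 3)%N -> (j < 3)%N -> (i != 0)%N || (j != 0)%N ->
    exists P, form_denom infty 5 (w0 *+ i + w1 *+ j) P.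
  case: i => [|[|[|i]]] //; case: j => [|[|[|j]]] // _ _ _;
    rewrite ?mulr0n ?mulr1n ?mul2 ?addr0 ?add0r //.
  - exact: DN.
  - by have /DN := D21; rewrite opprB.
  - exact: DN.
  - by rewrite addrC.
  - by have /DN := D11; rewrite opprD.
have lt3 (x : 'F_3) : (x < 3)%N by exact: ltn_ord x.
have denomP (c : 'I_2 -> 'F_3) : (c ord0 != 0) || (c (lift ord0 ord0) != 0) ->
    exists P, form_denom infty 5 (Fp_comb w c) P.
  by rewrite comb => c0; apply: denom.
have free_w (c : 'I_2 -> 'F_3) : Fp_comb w c = 0 -> forall i, c i = 0.
  move=> wc0; have /norP[] : ~~ ((c ord0 != 0) || (c (lift ord0 ord0) != 0)).
    apply/negP => /denomP[P [_ + _]]; rewrite wc0 mulr0 => /esym/eqP.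
    by rewrite tofrac_eq0 expf_eq0 (negbTE (inf_coord_neq0 infty)) andbF.
  move=> /negbNE/eqP c0 /negbNE/eqP c1 i; case: (unliftP ord0 i) => [j ->|-> //].
  by rewrite ord1.
exists (fun g => exists c : 'I_2 -> 'F_3, g = Fp_comb w c); split.
- by exists w.
- move=> _ [c ->]; rewrite comb.
  have -> : w0 *+ c ord0 + w1 *+ c (lift ord0 ord0) =
      dlogp (F0 ^+ c ord0 * F1 ^+ c (lift ord0 ord0)).
    by rewrite dlogpM ?expf_neq0 // !dlogpX // -EF0 -EF1.
  by apply: logarithmic_dlogp; rewrite mulf_neq0 ?expf_neq0.
- move=> _ [c ->] wc0; have [P D] : exists P, form_denom infty 5 (Fp_comb w c) P.
    apply: denomP; apply: contraNT wc0; rewrite negb_or !negbK => /andP[/eqP c0 /eqP c1].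
    by rewrite comb c0 c1 !mulr0n addr0.
  exact: form_denom_only_zero D.
Qed.

End CharThree.

(** * The three cases m + 1 = l p with l = 1, 2, 3, where the pencil has degree l p *)

Theorem theorem2p9 (k : closedFieldType) (p : nat) (hp : p \in [pchar k])
    (hp3 : (3 <= p)%N) (m : nat) (hm : (1 <= m)%N) (infty : P1 k) :
  [/\ (m + 1 = p)%N -> ~ (exists V : ratfun k -> Prop, is_L p infty m 2 V),
      (m + 1 = 2 * p)%N ->
        ((exists V : ratfun k -> Prop, is_L p infty m 2 V) <-> p = 3%N)
    & (m + 1 = 3 * p)%N -> ~ (exists V : ratfun k -> Prop, is_L p infty m 2 V)].
Proof.
have no_L l : (0 < l <= 3)%N -> ~~ ((l == 2) && (p == 3))%N -> (m + 1 = l * p)%N ->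
    ~ (exists V : ratfun k -> Prop, is_L p infty m 2 V).
  move=> l13 lp ml [V /(is_L_log_pencil hp hm)[P0 [P1 [P00 P10]]]].
  by rewrite -addn1 ml mulnC; apply: no_log_pencil.
split=> [mp|mp|mp]; [by apply: (no_L 1%N); rewrite ?mul1n | split | exact: (no_L 3%N)].
  move=> exL; apply/eqP; apply: contraPT exL => p3.
  by apply: (no_L 2%N); rewrite ?(negbTE p3).
move=> p3; rewrite p3 in hp mp *.
by rewrite (_ : m = 5)%N; [exact: exists_L_char3 | lia].
Qed.
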